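(* Let $d \geq 2$ and let $\Omega = I \times \Sigma \subset \mathbb{R}^d$ be a cylindric set of positive Lebesgue measure, where $I \subset \mathbb{R}$ is an interval and $\Sigma \subset \mathbb{R}^{d-1}$ is a measurable set. Then $\Omega$ is a spectral set (as a set in $\mathbb{R}^d$) if and only if its base $\Sigma$ is a spectral set (as a set in $\mathbb{R}^{d-1}$).
   Context: A bounded, measurable set $\Omega \subset \mathbb{R}^d$ ($d \geq 2$) is called a cylindric set if it has the form $\Omega = I \times \Sigma$, where $I$ is an interval in $\mathbb{R}$ and $\Sigma$ is a measurable set in $\mathbb{R}^{d-1}$; the set $\Sigma$ is called its base. Since $\Omega$ is bounded and of positive measure, $I$ is a bounded interval of positive length and $\Sigma$ is bounded of positive measure. Let $\Omega \subset \mathbb{R}^m$ be a bounded, measurable set of positive Lebesgue measure. A discrete set $\Lambda \subset \mathbb{R}^m$ is called a spectrum for $\Omega$ if the system of exponential functions $E(\Lambda) = \{e_\lambda\}_{\lambda \in \Lambda}$, $e_\lambda(x) = e^{2\pi i \langle \lambda, x\rangle}$, is an orthogonal basis of $L^2(\Omega)$, that is, the system is orthogonal and complete in $L^2(\Omega)$. A set $\Omega$ which admits a spectrum is called a spectral set. *)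

(* Defs.v *)
From HB Require Import structures.
From mathcomp Require Import all_boot all_order all_algebra.
From mathcomp Require Import complex.
From mathcomp Require Import all_classical all_reals all_analysis.

Set Implicit Arguments.
Unset Strict Implicit.
Unset Printing Implicit Defensive.

Import Order.TTheory GRing.Theory Num.Theory.
Import complex.ComplexField.Normc.

Local Open Scope classical_set_scope.
Local Open Scope ring_scope.
Local Open Scope complex_scope.

(* R^n is represented by n.-tuple R, with the library's Borel (product)
   sigma-algebra. *)

Section cons_measure.
Context (R : realType) (n : nat).
Variable mu : {sigma_finite_measure set (n.-tuple R) -> \bar R}.

Definition cons_pair (p : measurableTypeR R * n.-tuple R) : n.+1.-tuple R :=
  [tuple of p.1 :: p.2].

Lemma measurable_cons_pair : measurable_fun setT cons_pair.
Proof.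
exact: (@measurable_cons _ _ (measurableTypeR R * n.-tuple R)%type R fst n snd).
Qed.

(* The product of the Lebesgue measure of the line and of mu, transported to
   R^(n.+1) = R * R^n. *)
Definition cons_measure : set (n.+1.-tuple R) -> \bar R :=
  pushforward (lebesgue_measure \x mu)%E cons_pair.

Let cons_measure0 : cons_measure set0 = 0%E.
Proof. by rewrite /cons_measure /pushforward preimage_set0 measure0. Qed.

Let cons_measure_ge0 A : (0 <= cons_measure A)%E.
Proof. by rewrite /cons_measure /pushforward; exact: measure_ge0. Qed.

Let cons_measure_sigma_additive : semi_sigma_additive cons_measure.
Proof.
move=> F mF tF mUF; rewrite /cons_measure /pushforward preimage_bigcup.
apply: measure_semi_sigma_additive.
- by move=> i; rewrite -[X in measurable X]setTI; exact: measurable_cons_pair.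
- apply/trivIsetP => i j _ _ ij; rewrite -preimage_setI.
  by move/trivIsetP : tF => ->//; rewrite preimage_set0.
- rewrite -preimage_bigcup -[X in measurable X]setTI.
  exact: measurable_cons_pair.
Qed.

HB.instance Definition _ := isMeasure.Build _ _ _ cons_measure
  cons_measure0 cons_measure_ge0 cons_measure_sigma_additive.

Let cons_measure_sigma_finite : sigma_finite setT cons_measure.
Proof.
have /sigma_finiteP[F [TF ndF Foo]] := sigma_finiteT (@lebesgue_measure R).
have /sigma_finiteP[G [TG ndG Goo]] := sigma_finiteT mu.
pose u (x : n.+1.-tuple R) : measurableTypeR R * n.-tuple R :=
  (thead x, [tuple of behead x]).
have consK : cancel cons_pair u.
  by move=> [a b]; congr pair => //; exact: val_inj.
have mu_ : measurable_fun setT u.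
  apply: measurable_fun_pair; first exact: measurable_tnth.
  exact: measurable_behead.
exists (fun i => u @^-1` (F i `*` G i)).
  rewrite -preimage_bigcup; apply/esym/seteqP; split => // x _ /=.
  have [i _ Fi] : (\bigcup_i F i) (u x).1 by rewrite -TF.
  have [j _ Gj] : (\bigcup_i G i) (u x).2 by rewrite -TG.
  exists (maxn i j) => //; split.
    exact: (subsetPset _ _ (ndF _ _ (leq_maxl i j))) Fi.
  exact: (subsetPset _ _ (ndG _ _ (leq_maxr i j))) Gj.
move=> i; have [mF Fi] := Foo i; have [mG Gi] := Goo i; split.
  rewrite -[X in measurable X]setTI; apply: mu_ => //.
  exact: measurableX.
rewrite /cons_measure /pushforward -comp_preimage.
rewrite (_ : u \o cons_pair = id); last by apply/funext => p; exact: consK.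
rewrite preimage_id product_measure1E//.
by rewrite lte_mul_pinfty// ge0_fin_numE.
Qed.

HB.instance Definition _ := @Measure_isSigmaFinite.Build _ _ _ cons_measure
  cons_measure_sigma_finite.

End cons_measure.

Fixpoint borel_lebesgue (R : realType) (n : nat) :
    {sigma_finite_measure set (n.-tuple R) -> \bar R} :=
  match n with
  | 0 => \d_([tuple] : 0.-tuple R)
  | m.+1 => cons_measure (borel_lebesgue R m)
  end.


Section lebesgue_Rn.
Context (R : realType) (n : nat).

(* R^n with the sigma-algebra of its Lebesgue measurable sets, i.e., of the sets
   that are Caratheodory measurable for the outer measure of borel_lebesgue
   (this is how the library obtains completed_lebesgue_measure for n = 1). *)
Definition Rn : Type := caratheodory_type (mu_ext (borel_lebesgue R n)).

HB.instance Definition _ := Measurable.on Rn.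

Definition lebesgue : set Rn -> \bar R :=
  @completed_measure_extension _ _ _ (borel_lebesgue R n).

Lemma lebesgue_is_complete : measure_is_complete lebesgue.
Proof. exact: measure_is_complete_caratheodory. Qed.

End lebesgue_Rn.

Section spectral_sets.
Context (R : realType) (n : nat).
Implicit Types (Omega L : set (Rn R n)) (f g : Rn R n -> R[i]).

Definition bounded_Rn Omega : Prop :=
  exists M : R, forall x, Omega x -> forall i, `|tnth x i| <= M.

(* Every point of L is isolated in L (for the sup distance of R^n). *)
Definition discrete_Rn L : Prop :=
  forall x, L x -> exists2 e : R, 0 < e &
    forall y, L y -> (forall i, `|tnth x i - tnth y i| < e) -> y = x.

Definition dotp (x y : Rn R n) : R := \sum_(i < n) tnth x i * tnth y i.

Definition expo (lambda x : Rn R n) : R[i] :=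
  cos (2 * pi * dotp lambda x) +i* sin (2 * pi * dotp lambda x).

Definition cintegral Omega f : R[i] :=
  (\int[@lebesgue R n]_(x in Omega) complex.Re (f x)) +i*
  (\int[@lebesgue R n]_(x in Omega) complex.Im (f x)).

Definition inner_L2 Omega f g : R[i] :=
  cintegral Omega (fun x => f x * conjc (g x)).

(* The square of the L^2(Omega) norm, possibly infinite. *)
Definition sqnorm_L2 Omega f : \bar R :=
  (\int[@lebesgue R n]_(x in Omega) (normc (f x) ^+ 2)%:E)%E.

Definition in_L2 Omega f : Prop :=
  [/\ measurable_fun Omega (fun x => complex.Re (f x)),
      measurable_fun Omega (fun x => complex.Im (f x)) &
      (sqnorm_L2 Omega f < +oo)%E].

Definition orthogonal_system Omega L : Prop :=
  forall lambda mu, L lambda -> L mu -> lambda <> mu ->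
    inner_L2 Omega (expo lambda) (expo mu) = 0.

(* The linear span of E(L) is dense in L^2(Omega). *)
Definition complete_system Omega L : Prop :=
  forall f, in_L2 Omega f -> forall e : R, 0 < e ->
    exists (s : seq (n.-tuple R)) (c : Rn R n -> R[i]),
      (forall lambda, lambda \in s -> L lambda) /\
      (sqnorm_L2 Omega
         (fun x => f x - \sum_(lambda <- s) c lambda * expo lambda x)%R
       < (e ^+ 2)%:E)%E.

Definition is_spectrum Omega L : Prop :=
  [/\ discrete_Rn L, orthogonal_system Omega L & complete_system Omega L].

Definition spectral_set Omega : Prop :=
  [/\ bounded_Rn Omega, measurable Omega, (0 < lebesgue Omega)%E &
      exists L, is_spectrum Omega L].

End spectral_sets.

Definition cylinder (R : realType) (d : nat) (I : set R)
    (Sigma : set (Rn R d.-1)) : set (Rn R d) :=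
  [set x : d.-tuple R | I (head 0 x) /\ Sigma [tuple of behead x]].

Definition cylindric (R : realType) (d : nat) (Omega : set (Rn R d))
    (I : set R) (Sigma : set (Rn R d.-1)) : Prop :=
  [/\ bounded_Rn Omega, measurable Omega, is_interval I,
      measurable Sigma & Omega = cylinder I Sigma].

(* Main.v *)
From HB Require Import structures.
From mathcomp Require Import all_boot all_order all_algebra.
From mathcomp Require Import complex.
From mathcomp Require Import all_classical all_reals all_analysis.
From mathcomp Require Import measurable_realfun.
From mathcomp Require Import ring lra.
Require Import Defs.
Set Implicit Arguments.
Unset Strict Implicit.
Unset Printing Implicit Defensive.

Import Order.TTheory GRing.Theory Num.Theory.
Import numFieldTopology.Exports numFieldNormedType.Exports.
Import complex.ComplexField.Normc.

Local Open Scope classical_set_scope.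
Local Open Scope ring_scope.
Local Open Scope complex_scope.

(** Write [a, b] for the closure of I and ell for its length, S for the base
    Sigma, e_s for the exponential of frequency s and M for the measure of S.

    If L is a spectrum of the base, the products of the exponentials e_s, s in
    L, with the Fourier basis of I form a spectrum of the cylinder.  They are
    orthogonal because inner products of products factor ([inner_tensor]), and
    complete because the closed span of products contains the indicators of all
    rectangles ([tensor_complete]).  The completeness of the Fourier basis
    ([fourier_complete]) rests on the fact that the trigonometric polynomials
    form an algebra: composing one of degree one with polynomials that converge
    to a step function yields the indicators of arcs.

    Conversely, let L be a spectrum of the cylinder; its points are pairs (t, s).
    For x in R consider the slice of the points with x <= t < x + 1 / ell.  The
    Fourier transform of the indicator of I does not vanish at t - t' when
    |t - t'| < 1 / ell, so the orthogonality of the exponentials of a slice has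
    to come from the base: the frequencies s of a slice are orthogonal on S.  For
    a fixed frequency k the Bessel inequality thus bounds
      h x := the sum of |<e_k, e_s>|^2 over the slice at x
    by M ^ 2.  Let w be the square modulus of the Fourier transform of the
    indicator of I.  On the cylinder, Parseval equality for the exponential of
    frequency (u, k) says that the sum of w (u - t) |<e_k, e_s>|^2 over L is
    (ell M) ^ 2 whatever u is; integrating over one period, the integral of h w
    is ell M ^ 2 ([integral_h]).  On the other hand the Bessel inequality for the
    Fourier basis of I, integrated over a period, shows that the integral of w is
    at most ell ([integral_fwin2_le]).  Hence (M ^ 2 - h) w is a nonnegative
    function whose integral is not positive, and h = M ^ 2 almost everywhere near
    the origin, where w > 0 ([h_ae]).  As the spectrum is countable, one x serves
    for every k occurring in it ([slice_approximable]): the closed span of the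
    slice at x contains all these e_k.  Finally the e_k span L2(S), because a
    function of the base is approximated on the cylinder, hence on some
    horizontal section of it ([base_approximable]).  So the slice at x is a
    spectrum of the base ([slice_spectrum]).

    Both arguments take place on the product of the line with the Borel space of
    (n)-tuples.  Lebesgue measurable sets agree with Borel sets up to Borel null
    sets ([borel_hull]), which transfers inner products and closed spans to and
    from this model.  Spectra are discrete by orthogonality alone
    ([orthogonal_discrete]). *)

(** * Square integrable functions and closed spans *)

Section normc_square.
Context (R : realType).
Implicit Types z w : R[i].

Lemma normc2E z : normc z ^+ 2 = complex.Re z ^+ 2 + complex.Im z ^+ 2.
Proof.
by case: z => a b; rewrite /normc /= sqr_sqrtr// addr_ge0// sqr_ge0.
Qed.

Lemma normc2_ge0 z : 0 <= normc z ^+ 2.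
Proof. exact: sqr_ge0. Qed.

Lemma normc2M z w : normc (z * w) ^+ 2 = normc z ^+ 2 * normc w ^+ 2.
Proof. by rewrite normcM exprMn. Qed.

Lemma normc2D_le z w :
  normc (z + w) ^+ 2 <= 2 * normc z ^+ 2 + 2 * normc w ^+ 2.
Proof.
rewrite !normc2E; case: z w => [a b] [a' b'] /=.
have := sqr_ge0 (a - a'); have := sqr_ge0 (b - b'); nra.
Qed.

Lemma ReM z w : complex.Re (z * w) =
  complex.Re z * complex.Re w - complex.Im z * complex.Im w.
Proof. by case: z w => [a b] [c d]. Qed.

Lemma ImM z w : complex.Im (z * w) =
  complex.Re z * complex.Im w + complex.Im z * complex.Re w.
Proof. by case: z w => [a b] [c d] /=; rewrite addrC. Qed.

Lemma ReD z w : complex.Re (z + w) = complex.Re z + complex.Re w.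
Proof. by case: z w => [a b] [c d]. Qed.

Lemma ImD z w : complex.Im (z + w) = complex.Im z + complex.Im w.
Proof. by case: z w => [a b] [c d]. Qed.

End normc_square.

Section closed_span.
Context d (T : measurableType d) (R : realType).
Variables (mu : {measure set T -> \bar R}) (D : set T).
Hypothesis mD : measurable D.
Implicit Types f g h : T -> R[i].

Definition cmeasurable f :=
  measurable_fun D (fun x => complex.Re (f x)) /\
  measurable_fun D (fun x => complex.Im (f x)).

Definition sqnorm f : \bar R := (\int[mu]_(x in D) (normc (f x) ^+ 2)%:E)%E.

Lemma cmeasurable_cst c : cmeasurable (fun=> c).
Proof. by split; exact: measurable_cst. Qed.

Lemma cmeasurableD f g : cmeasurable f -> cmeasurable g ->
  cmeasurable (fun x => f x + g x).
Proof.
move=> [f1 f2] [g1 g2]; split.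
  by under eq_fun do rewrite ReD; exact: measurable_funD.
by under eq_fun do rewrite ImD; exact: measurable_funD.
Qed.

Lemma cmeasurableM f g : cmeasurable f -> cmeasurable g ->
  cmeasurable (fun x => f x * g x).
Proof.
move=> [f1 f2] [g1 g2]; split.
  by under eq_fun do rewrite ReM; apply: measurable_funB; exact: measurable_funM.
by under eq_fun do rewrite ImM; apply: measurable_funD; exact: measurable_funM.
Qed.

Lemma cmeasurableZ c f : cmeasurable f -> cmeasurable (fun x => c * f x).
Proof. exact/cmeasurableM/cmeasurable_cst. Qed.

Lemma cmeasurableB f g : cmeasurable f -> cmeasurable g ->
  cmeasurable (fun x => f x - g x).
Proof.
move=> mf /(cmeasurableZ (-1)) mg.
rewrite (_ : (fun x => _) = fun x => f x + -1 * g x); first exact: cmeasurableD.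
by apply/funext => x; rewrite mulN1r.
Qed.

Lemma cmeasurable_sum (I : eqType) (s : seq I) (F : I -> T -> R[i]) :
  (forall i, i \in s -> cmeasurable (F i)) ->
  cmeasurable (fun x => \sum_(i <- s) F i x).
Proof.
elim: s => [_|i s IH sF].
  by under eq_fun do rewrite big_nil; exact: cmeasurable_cst.
under eq_fun do rewrite big_cons; apply: cmeasurableD.
  by apply: sF; rewrite mem_head.
by apply: IH => j js; apply: sF; rewrite inE js orbT.
Qed.

Lemma measurable_normc2 f : cmeasurable f ->
  measurable_fun D (fun x => normc (f x) ^+ 2).
Proof.
move=> [f1 f2]; under eq_fun do rewrite normc2E.
by apply: measurable_funD; exact: measurable_funX.
Qed.

Lemma emeasurable_normc2 f : cmeasurable f ->
  measurable_fun D (fun x => (normc (f x) ^+ 2)%:E).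
Proof. by move=> mf; apply/measurable_EFinP; exact: measurable_normc2. Qed.

Lemma sqnorm_ge0 f : (0 <= sqnorm f)%E.
Proof. by apply: integral_ge0 => x _; rewrite lee_fin normc2_ge0. Qed.

Lemma sqnormZ c f : cmeasurable f ->
  sqnorm (fun x => c * f x) = ((normc c ^+ 2)%:E * sqnorm f)%E.
Proof.
move=> mf; rewrite /sqnorm; under eq_integral do rewrite normc2M EFinM.
rewrite ge0_integralZl//.
- exact: emeasurable_normc2.
- by move=> x _; rewrite lee_fin normc2_ge0.
- by rewrite lee_fin normc2_ge0.
Qed.

Lemma sqnormD_le f g : cmeasurable f -> cmeasurable g ->
  (sqnorm (fun x => f x + g x)%R <= 2%:E * sqnorm f + 2%:E * sqnorm g)%E.
Proof.
move=> mf mg.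
rewrite -!ge0_integralZl//; last first.
- by move=> x _; rewrite lee_fin normc2_ge0.
- exact: emeasurable_normc2.
- by move=> x _; rewrite lee_fin normc2_ge0.
- exact: emeasurable_normc2.
have m2 h : cmeasurable h ->
    measurable_fun D (fun x => 2%:E * (normc (h x) ^+ 2)%:E)%E.
  move=> mh; under eq_fun do rewrite -EFinM.
  by apply/measurable_EFinP; apply: measurable_funM => //; exact: measurable_normc2.
have p2 h x : (0 <= 2%:E * (normc (h x) ^+ 2)%:E :> \bar R)%E.
  by rewrite -EFinM lee_fin mulr_ge0// normc2_ge0.
rewrite -ge0_integralD//; last 2 first.
- exact: m2.
- exact: m2.
apply: ge0_le_integral => //.
- by move=> x _; rewrite lee_fin normc2_ge0.
- by apply: emeasurable_normc2; exact: cmeasurableD.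
- by apply: emeasurable_funD; exact: m2.
- by move=> x _; rewrite -!EFinM -EFinD lee_fin; exact: normc2D_le.
Qed.

Context (K : choiceType).
Implicit Types (L : set K) (E : K -> T -> R[i]).

Definition span L E : set (T -> R[i]) :=
  [set h | exists (s : seq K) (c : K -> R[i]),
    (forall l, l \in s -> L l) /\ h = (fun x => \sum_(l <- s) c l * E l x)].

(** Membership in the L2(D)-closure of the linear span of the functions E l,
    for l in L. *)
Definition approximable L E f := forall e : R, 0 < e ->
  exists2 h, span L E h & (sqnorm (fun x => f x - h x)%R < e%:E)%E.

(** A linear combination may list a frequency several times; collecting equal
    terms multiplies its coefficient by the number of occurrences. *)
Lemma big_undup_count (s : seq K) (F : K -> R[i]) :
  \sum_(l <- s) F l = \sum_(l <- undup s) (count_mem l s)%:R * F l.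
Proof.
rewrite -big_undup_iterop_count; apply: eq_bigr => l _.
by rewrite Monoid.iteropE mulr_natl; elim: (count_mem l s) => //= n ->;
  rewrite mulrS.
Qed.

Lemma span_uniq L E h : span L E h -> exists (s : seq K) (c : K -> R[i]),
  [/\ uniq s, forall l, l \in s -> L l &
    h = (fun x => \sum_(l <- s) c l * E l x)].
Proof.
move=> [s [c [sL ->]]].
exists (undup s), (fun l => (count_mem l s)%:R * c l); split.
- exact: undup_uniq.
- by move=> l; rewrite mem_undup; exact: sL.
- apply/funext => x; rewrite big_undup_count.
  by apply: eq_bigr => l _; rewrite mulrA.
Qed.

Lemma spanZ L E a h : span L E h -> span L E (fun x => a * h x).
Proof.
move=> [s [c [sL ->]]]; exists s, (fun l => a * c l); split => //.
by apply/funext => x; rewrite mulr_sumr; apply: eq_bigr => l _; rewrite mulrA.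
Qed.

Lemma spanD L E g h : span L E g -> span L E h -> span L E (fun x => g x + h x).
Proof.
move=> [s [c [sL ->]]] [t [b [tL ->]]].
have ext (u v : seq K) (a : K -> R[i]) x : {subset u <= v} ->
    \sum_(l <- u) a l * E l x =
    \sum_(l <- undup v) (count_mem l u)%:R * a l * E l x.
  move=> uv; rewrite big_undup_count [RHS](bigID (mem u))/= [X in _ + X]big1.
    rewrite addr0 -[RHS]big_filter; under eq_bigr do rewrite mulrA.
    apply: perm_big; apply: uniq_perm; rewrite ?undup_uniq ?filter_uniq//.
      exact: undup_uniq.
    move=> l; rewrite mem_filter !mem_undup; case: (boolP (l \in u)) => //=.
    by move=> /uv ->.
  by move=> l lu; rewrite (count_memPn lu) !mul0r.
exists (undup (s ++ t)),
  (fun l => (count_mem l s)%:R * c l + (count_mem l t)%:R * b l); split.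
  by move=> l; rewrite mem_undup mem_cat => /orP[/sL|/tL].
apply/funext => x; rewrite (ext s (s ++ t)) 1?(ext t (s ++ t)).
- by rewrite -big_split/=; apply: eq_bigr => l _; rewrite mulrDl.
- by move=> l lt; rewrite mem_cat lt orbT.
- by move=> l ls; rewrite mem_cat ls.
Qed.

Lemma span0 L E : span L E (fun=> 0).
Proof.
by exists [::], (fun=> 0); split => //; apply/funext => x; rewrite big_nil.
Qed.

Lemma span_mem L E l : L l -> span L E (E l).
Proof.
move=> Ll; exists [:: l], (fun=> 1); split.
  by move=> m; rewrite inE => /eqP ->.
by apply/funext => x; rewrite big_seq1 mul1r.
Qed.

Lemma span_ind L E (P : set (T -> R[i])) : P (fun=> 0) ->
  (forall g h, P g -> P h -> P (fun x => g x + h x)) ->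
  (forall a l, L l -> P (fun x => a * E l x)) ->
  span L E `<=` P.
Proof.
move=> P0 PD PE h [s [c [sL ->]]]; elim: s sL => [|l s IH] sL.
  by under eq_fun do rewrite big_nil.
under eq_fun do rewrite big_cons; apply: PD.
  by apply: PE; apply: sL; rewrite mem_head.
by apply: IH => m ms; apply: sL; rewrite inE ms orbT.
Qed.

Lemma cmeasurable_span L E h : (forall l, L l -> cmeasurable (E l)) ->
  span L E h -> cmeasurable h.
Proof.
move=> mE; move: h; apply: span_ind.
- exact: cmeasurable_cst.
- by move=> g h; exact: cmeasurableD.
- by move=> a l /mE; exact: cmeasurableZ.
Qed.

Lemma span_approximable L E h : span L E h -> approximable L E h.
Proof.
move=> Lh e e0; exists h => //; rewrite /sqnorm.
under eq_integral do rewrite subrr normc2E/= expr0n addr0.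
by rewrite integral0 lte_fin.
Qed.

Lemma approximable_eq L E f g : {in D, f =1 g} ->
  approximable L E f -> approximable L E g.
Proof.
move=> fg Lf e e0; have [h Lh fh] := Lf _ e0; exists h => //.
by rewrite /sqnorm; under eq_integral => x xD do rewrite -fg//.
Qed.

Section approximable_closure.
Variables (L : set K) (E : K -> T -> R[i]).
Hypothesis mE : forall l, L l -> cmeasurable (E l).

(** The triangle inequality is replaced by [sqnormD_le], which loses a factor 2
    at each use. *)
Lemma approximable_closed f : cmeasurable f ->
  (forall e : R, 0 < e -> exists g, [/\ cmeasurable g, approximable L E g &
     (sqnorm (fun x => f x - g x)%R < e%:E)%E]) ->
  approximable L E f.
Proof.
move=> mf fg e e0; have e40 : 0 < e / 4 by rewrite divr_gt0.
have [g [mg Lg fge]] := fg _ e40; have [h Lh ghe] := Lg _ e40.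
have mh := cmeasurable_span mE Lh.
exists h => //.
rewrite (_ : (fun x => _) = fun x => (f x - g x) + (g x - h x)); last first.
  by apply/funext => x; rewrite addrA subrK.
apply: (le_lt_trans (sqnormD_le (cmeasurableB mf mg) (cmeasurableB mg mh))).
rewrite [X in (_ < X)%E](_ : _ = 2%:E * (e / 4)%:E + 2%:E * (e / 4)%:E)%E.
  by apply: lteD; rewrite lte_pmul2l.
by rewrite -!EFinM -EFinD; congr EFin; field.
Qed.

Lemma approximableD f g : cmeasurable f -> cmeasurable g ->
  approximable L E f -> approximable L E g ->
  approximable L E (fun x => f x + g x).
Proof.
move=> mf mg Lf Lg e e0; have e40 : 0 < e / 4 by rewrite divr_gt0.
have [f' Lf' ff'] := Lf _ e40; have [g' Lg' gg'] := Lg _ e40.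
have mf' := cmeasurable_span mE Lf'; have mg' := cmeasurable_span mE Lg'.
exists (fun x => f' x + g' x); first exact: spanD.
rewrite (_ : (fun x => _) = fun x => (f x - f' x) + (g x - g' x)); last first.
  by apply/funext => x; rewrite opprD addrACA.
apply: (le_lt_trans (sqnormD_le (cmeasurableB mf mf') (cmeasurableB mg mg'))).
rewrite [X in (_ < X)%E](_ : _ = 2%:E * (e / 4)%:E + 2%:E * (e / 4)%:E)%E.
  by apply: lteD; rewrite lte_pmul2l.
by rewrite -!EFinM -EFinD; congr EFin; field.
Qed.

Lemma approximableZ a f : cmeasurable f ->
  approximable L E f -> approximable L E (fun x => a * f x).
Proof.
move=> mf Lf e e0.
have a0 : 0 < normc a ^+ 2 + 1 by rewrite ltr_wpDl// normc2_ge0.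
have [h Lh fh] := Lf _ (divr_gt0 e0 a0).
exists (fun x => a * h x); first exact: spanZ.
rewrite (_ : (fun x => _) = fun x => a * (f x - h x)); last first.
  by apply/funext => x; rewrite mulrBr.
have mh := cmeasurable_span mE Lh.
rewrite sqnormZ; last exact: cmeasurableB.
apply: (@le_lt_trans _ _ ((normc a ^+ 2)%:E * (e / (normc a ^+ 2 + 1))%:E)%E).
  by apply: lee_wpmul2l; [rewrite lee_fin normc2_ge0|exact: ltW].
rewrite -EFinM lte_fin mulrCA -[ltRHS]mulr1 ltr_pM2l// ltr_pdivrMr// mul1r.
by rewrite ltrDl.
Qed.

Lemma approximable_ae f g : cmeasurable f -> cmeasurable g ->
  ae_eq mu D f g -> approximable L E f -> approximable L E g.
Proof.
move=> mf mg fg Lf e e0; have [h Lh fh] := Lf _ e0; exists h => //.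
have mh := cmeasurable_span mE Lh.
apply: le_lt_trans fh; rewrite le_eqVlt; apply/orP; left; apply/eqP.
apply: ge0_ae_eq_integral => //.
- by apply: emeasurable_normc2; exact: cmeasurableB.
- by apply: emeasurable_normc2; exact: cmeasurableB.
- by move=> x _; rewrite lee_fin normc2_ge0.
- by move=> x _; rewrite lee_fin normc2_ge0.
- by apply: filterS fg => x fgx Dx; rewrite fgx.
Qed.

End approximable_closure.

Lemma approximable_sum (I : eqType) (s : seq I) (F : I -> T -> R[i]) L E :
  (forall l, L l -> cmeasurable (E l)) ->
  (forall i, i \in s -> cmeasurable (F i)) ->
  (forall i, i \in s -> approximable L E (F i)) ->
  approximable L E (fun x => \sum_(i <- s) F i x).
Proof.
move=> mE; elim: s => [_ _|i s IH sF LF].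
  by under eq_fun do rewrite big_nil; apply: span_approximable; exact: span0.
under eq_fun do rewrite big_cons; apply: approximableD => //.
- by apply: sF; rewrite mem_head.
- by apply: cmeasurable_sum => j js; apply: sF; rewrite inE js orbT.
- by apply: LF; rewrite mem_head.
- by apply: IH => j js; [apply: sF|apply: LF]; rewrite inE js orbT.
Qed.

End closed_span.

(** Approximable functions are stable under linear combinations and limits. *)
Lemma approximable_trans d (T : measurableType d) (R : realType)
    (mu : {measure set T -> \bar R}) (D : set T) (K K' : choiceType)
    (L : set K) (E : K -> T -> R[i]) (L' : set K') (E' : K' -> T -> R[i]) f :
  measurable D ->
  (forall l, L l -> cmeasurable D (E l)) ->
  (forall l, L' l -> cmeasurable D (E' l)) ->
  (forall l, L l -> approximable mu D L' E' (E l)) ->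
  cmeasurable D f -> approximable mu D L E f -> approximable mu D L' E' f.
Proof.
move=> mD mE mE' LL' mf Lf; apply: approximable_closed => // e e0.
have [h Lh fh] := Lf _ e0.
exists h; split => //; first exact: cmeasurable_span Lh.
suff [] : cmeasurable D h /\ approximable mu D L' E' h by [].
move: h Lh {fh}; apply: span_ind.
- by split; [exact: cmeasurable_cst|apply: span_approximable; exact: span0].
- move=> g h [mg Lg] [mh Lh]; split; first exact: cmeasurableD.
  exact: approximableD.
- move=> a l Ll; split; first exact/cmeasurableZ/mE.
  by apply: approximableZ => //; [exact: mE|exact: LL'].
Qed.

(** * Density: reduction to indicator functions *)

Lemma indicU_disj (T : Type) (R : realType) (A B : set T) x :
  A `&` B = set0 -> \1_(A `|` B) x = \1_A x + \1_B x :> R.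
Proof.
move=> AB; rewrite !indicE in_setU.
case: (boolP (x \in A)) => /= [|_]; last by rewrite add0r.
rewrite inE => Ax; rewrite memNset ?addr0// => Bx.
by have : (A `&` B) x by []; rewrite AB.
Qed.

Section density.
Import HBNNSimple.
Context d (T : measurableType d) (R : realType).
Variables (mu : {measure set T -> \bar R}) (D : set T).
Hypothesis mD : measurable D.
Context (K : choiceType) (L : set K) (E : K -> T -> R[i]).
Hypothesis mE : forall l, L l -> cmeasurable D (E l).

Definition cindic (A : set T) : T -> R[i] := fun x => (\1_A x)%:C.

Lemma cmeasurable_real (g : T -> R) : measurable_fun D g ->
  cmeasurable D (fun x => (g x)%:C).
Proof. by split => //; exact: measurable_cst. Qed.

Lemma normc2_real (r : R) : normc r%:C ^+ 2 = r ^+ 2.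
Proof. by rewrite normc2E/= expr0n addr0. Qed.

Lemma cmeasurable_indic A : measurable A -> cmeasurable D (cindic A).
Proof.
by move=> mA; apply: cmeasurable_real; apply: measurable_funTS; exact: measurable_indic.
Qed.

Lemma sqnorm_indic A : measurable A -> sqnorm mu D (cindic A) = mu (A `&` D).
Proof.
move=> mA; rewrite -integral_indic// /sqnorm; apply: eq_integral => x _.
by rewrite normc2_real indicE; case: (_ \in _); rewrite ?expr1n ?expr0n.
Qed.

(** A nonnegative square integrable function is the limit of an increasing
    sequence of simple functions, by which it is dominated. *)
Lemma approximable_ge0 (g : T -> R) :
  (forall A, measurable A -> approximable mu D L E (cindic A)) ->
  measurable_fun D g -> (forall x, D x -> 0 <= g x) ->
  (\int[mu]_(x in D) (g x ^+ 2)%:E < +oo)%E ->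
  approximable mu D L E (fun x => (g x)%:C).
Proof.
move=> LA mg g0 goo.
have mg' : measurable_fun D (EFin \o g) by exact/measurable_EFinP.
have g'0 x : D x -> (0 <= (EFin \o g) x)%E by move=> Dx; rewrite lee_fin g0.
pose sf := nnsfun_approx mD mg'.
pose phi n : T -> R := sf n.
have phi_g x : D x -> (fun n => phi n x) @ \oo --> g x.
  move=> Dx; have := cvg_nnsfun_approx mD mg' g'0 Dx.
  by move/fine_cvgP => -[_]; apply: cvg_trans; apply: near_eq_cvg; exact: nearW.
have phi_le n x : D x -> phi n x <= g x.
  by move=> Dx; rewrite -lee_fin /phi nnsfun_approxE; exact: le_approx.
have phi0 n x : 0 <= phi n x by rewrite /phi.
have mphi n : measurable_fun D (phi n) by exact: measurable_funTS.
have mB n : measurable_fun D (fun x => ((g x - phi n x) ^+ 2)%:E).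
  by apply/measurable_EFinP; apply: measurable_funX; exact: measurable_funB.
have mg2 : measurable_fun D (fun x => (g x ^+ 2)%:E).
  by apply/measurable_EFinP; exact: measurable_funX.
have [||||_ _] := @dominated_convergence _ _ _ mu D mD
    (fun n x => ((g x - phi n x) ^+ 2)%:E) (cst 0%E) (fun x => (g x ^+ 2)%:E) mB.
- exact: measurable_cst.
- apply: aeW => x Dx; apply: cvg_EFin; first exact: nearW.
  rewrite /= (_ : 0 = (g x - g x) ^+ 2); last by rewrite subrr expr0n.
  by apply: cvgM; apply: cvgB; [exact: cvg_cst|exact: phi_g|exact: cvg_cst|exact: phi_g].
- apply/integrableP; split => //.
  by under eq_integral do rewrite gee0_abs ?lee_fin ?sqr_ge0//.
- apply: aeW => x n Dx; rewrite gee0_abs ?lee_fin ?sqr_ge0//.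
  have := phi_le n _ Dx; have := phi0 n x; nra.
rewrite integral0 => cvg0.
apply: (approximable_closed mD mE); first exact: cmeasurable_real.
move=> e e0.
have /cvg0[n _ /(_ n (leqnn n)) /= ne] :
    nbhs (0%E : \bar R) [set x | (x < e%:E)%E].
  exact: (@open_ereal_lt_ereal R e%:E 0%E).
exists (fun x => (phi n x)%:C); split.
- exact: cmeasurable_real.
- rewrite (_ : (fun x => _) = fun x => \sum_(y <- finmap.enum_fset (fset_set (range (sf n))))
      y%:C * cindic (sf n @^-1` [set y]) x).
    apply: approximable_sum => // y _.
      apply: cmeasurableZ; apply: cmeasurable_indic; exact: measurable_sfunP.
    apply: approximableZ => //.
      by apply: cmeasurable_indic; exact: measurable_sfunP.
    by apply: LA; exact: measurable_sfunP.
  apply/funext => x; rewrite [in LHS]/phi (fimfunE (sf n) x) fsbig_finite//=.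
  rewrite raddf_sum; apply: eq_bigr => y _.
  by rewrite /cindic -rmorphM.
- apply: le_lt_trans ne; rewrite le_eqVlt; apply/orP; left; apply/eqP.
  apply: eq_integral => x _; rewrite -rmorphB normc2_real; congr EFin.
Qed.

(** The positive and negative parts of the real and imaginary parts of f are
    nonnegative and dominated by f. *)
Lemma approximable_of_indic f :
  (forall A, measurable A -> approximable mu D L E (cindic A)) ->
  cmeasurable D f -> (sqnorm mu D f < +oo)%E -> approximable mu D L E f.
Proof.
move=> LA mf foo.
have real_case (g : T -> R) : measurable_fun D g ->
    (forall x, g x ^+ 2 <= normc (f x) ^+ 2) ->
    approximable mu D L E (fun x => (g x)%:C).
  move=> mg gf.
  have part (h : T -> R) : measurable_fun D h -> (forall x, 0 <= h x) ->
      (forall x, h x ^+ 2 <= g x ^+ 2) ->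
      approximable mu D L E (fun x => (h x)%:C).
    move=> mh h0 hg; apply: approximable_ge0 => //.
    apply: le_lt_trans foo; apply: ge0_le_integral => //.
    - by move=> x _; rewrite lee_fin sqr_ge0.
    - by apply/measurable_EFinP; exact: measurable_funX.
    - exact: emeasurable_normc2.
    - by move=> x _; rewrite lee_fin (le_trans (hg x)).
  rewrite (_ : (fun x => _) = fun x =>
      (Num.max (g x) 0)%:C + (-1) * (Num.max (- g x) 0)%:C); last first.
    apply/funext => x; rewrite mulN1r -rmorphB; congr (_%:C).
    by case: (leP (g x) 0) => gx; case: leP; lra.
  have mp : measurable_fun D (fun x => Num.max (g x) 0).
    by apply: measurable_maxr => //; exact: measurable_cst.
  have mn : measurable_fun D (fun x => Num.max (- g x) 0).
    by apply: measurable_maxr; [exact: measurable_funN|exact: measurable_cst].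
  apply: approximableD => //.
  - by apply: cmeasurableZ => //; exact: cmeasurable_real.
  - apply: part => // x; first by rewrite le_max lexx orbT.
    by case: (leP (g x) 0) => _; rewrite ?expr0n ?sqr_ge0.
  - apply: approximableZ => //.
    apply: part => // x; first by rewrite le_max lexx orbT.
    by case: (leP (- g x) 0) => _; rewrite ?expr0n ?sqrrN ?sqr_ge0.
rewrite (_ : f = fun x => (complex.Re (f x))%:C + 'i * (complex.Im (f x))%:C); last first.
  by apply/funext => x; exact: complexE.
case: (mf) => mRe mIm.
apply: approximableD => //.
- by apply: cmeasurableZ => //; exact: cmeasurable_real.
- by apply: real_case => // x; rewrite normc2E lerDl sqr_ge0.
- apply: approximableZ => //.
  by apply: real_case => // x; rewrite normc2E lerDr sqr_ge0.
Qed.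

(** The measurable sets whose indicator lies in the closed span form a Dynkin
    system: relative complements are differences of indicators, and a countable
    disjoint union is an L2(D)-limit of finite ones because D has finite
    measure. *)
Lemma approximable_indic (G : set (set T)) : (mu D < +oo)%E ->
  @measurable _ T = <<s G >> -> setI_closed G ->
  approximable mu D L E (cindic setT) ->
  (forall A, G A -> approximable mu D L E (cindic A)) ->
  forall A, measurable A -> approximable mu D L E (cindic A).
Proof.
move=> Doo GE GI LT LG A mA.
suff : <<s G >> A -> approximable mu D L E (cindic A) by apply; rewrite -GE.
move: A {mA}; apply: dynkin_induction => //.
- move=> A mA LA; rewrite (_ : cindic (~` A) = fun x => cindic setT x + (-1) * cindic A x).
    apply: approximableD => //; [exact: cmeasurable_indic| |].
      by apply: cmeasurableZ; exact: cmeasurable_indic.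
    by apply: approximableZ => //; exact: cmeasurable_indic.
  apply/funext => x; rewrite mulN1r -rmorphB; congr (_%:C).
  by rewrite !indicE in_setC in_setT; case: (_ \in _) => /=; rewrite ?subrr ?subr0.
- move=> F mF tF LF.
  have mU : measurable (\bigcup_k F k) by exact: bigcupT_measurable.
  apply: (approximable_closed mD mE); first exact: cmeasurable_indic.
  move=> e e0.
  pose A n := \big[setU/set0]_(k < n) F k.
  have mA n : measurable (A n) by exact: bigsetU_measurable.
  pose B n := (\bigcup_k F k `\` A n) `&` D.
  have mB n : measurable (B n) by apply: measurableI => //; exact: measurableD.
  have : mu \o B @ \oo --> mu (\bigcap_n B n).
    apply: nonincreasing_cvg_mu.
    - apply: le_lt_trans Doo; apply: le_measure; rewrite ?inE//.
    - exact: subIsetr.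
    - exact: mB.
    - exact: bigcapT_measurable.
    - move=> n m nm; apply/subsetPset; apply: setSI; apply: setDS.
      exact: subset_bigsetU.
  rewrite (_ : \bigcap_n B n = set0); last first.
    apply/seteqP; split => // x Bx; have [[[k _ Fk] _] _] := Bx 0%N I.
    have [[_ +] _] := Bx k.+1 I; apply.
    by rewrite /A -bigcup_mkord; exists k => /=.
  rewrite measure0 => /(_ [set x | (x < e%:E)%E])[|n _ /(_ n (leqnn n)) /= ne].
    exact: (@open_ereal_lt_ereal R e%:E 0%E).
  exists (cindic (A n)); split; first exact: cmeasurable_indic.
    elim: n {ne} => [|n IH].
      rewrite (_ : cindic _ = fun=> 0).
        by apply: span_approximable; exact: span0.
      by apply/funext => x; rewrite /A big_ord0 /cindic indic0.
    rewrite (_ : cindic _ = fun x => cindic (A n) x + cindic (F n) x).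
      by apply: approximableD => //; exact: cmeasurable_indic.
    apply/funext => x; rewrite /A big_ord_recr/= /cindic -rmorphD indicU_disj//.
    apply/seteqP; split => // y; rewrite -bigcup_mkord => -[[k /= kn Fk] Fn].
    by move: kn; rewrite (tF k n _ _)// ?ltnn//; exists y.
  rewrite (_ : (fun x => _) = cindic (\bigcup_k F k `\` A n)).
    by rewrite sqnorm_indic//; exact: measurableD.
  apply/funext => x; rewrite /cindic -rmorphB; congr (_%:C).
  rewrite !indicE in_setD.
  have : x \in A n -> x \in \bigcup_k F k.
    by rewrite !inE /A -bigcup_mkord => -[k _ Fk]; exists k.
  case: (x \in A n) => [->//|_]; first by rewrite subrr.
  by rewrite andbT subr0.
Qed.

End density.

(** * Inner products, Bessel inequality and Parseval equality *)

Section complex_integral.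
Context d (T : measurableType d) (R : realType).
Variables (mu : {measure set T -> \bar R}) (D : set T).
Hypothesis mD : measurable D.
Hypothesis Doo : (mu D < +oo)%E.
Implicit Types f g h : T -> R[i].

Definition cbounded f :=
  cmeasurable D f /\ exists M, forall x, normc (f x) ^+ 2 <= M.

Definition cint f : R[i] :=
  (\int[mu]_(x in D) complex.Re (f x)) +i* (\int[mu]_(x in D) complex.Im (f x)).

Definition inner f g : R[i] := cint (fun x => f x * conjc (g x)).

Lemma cbounded_integrable f : cbounded f ->
  mu.-integrable D (EFin \o (fun x => complex.Re (f x))) /\
  mu.-integrable D (EFin \o (fun x => complex.Im (f x))).
Proof.
move=> [[mRe mIm] [M fM]].
suff int (g : T -> R) : measurable_fun D g -> (forall x, g x ^+ 2 <= M) ->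
    mu.-integrable D (EFin \o g).
  by split; apply: int => // x; apply: le_trans (fM x); rewrite normc2E;
    rewrite ?lerDl ?lerDr sqr_ge0.
move=> mg gM; apply: measurable_bounded_integrable => //.
exists (M + 1); split; first exact: num_real.
move=> y My x _; apply: le_trans (ltW My).
by have := gM x; rewrite -real_normK ?num_real//; have := normr_ge0 (g x); nra.
Qed.

Lemma cboundedM f g : cbounded f -> cbounded g -> cbounded (fun x => f x * g x).
Proof.
move=> [mf [M fM]] [mg [N gN]]; split; first exact: cmeasurableM.
exists (M * N) => x; rewrite normc2M.
by apply: ler_pM => //; exact: normc2_ge0.
Qed.

Lemma cboundedD f g : cbounded f -> cbounded g -> cbounded (fun x => f x + g x).
Proof.
move=> [mf [M fM]] [mg [N gN]]; split; first exact: cmeasurableD.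
exists (2 * M + 2 * N) => x; apply: (le_trans (normc2D_le _ _)).
by apply: lerD; rewrite ler_pM2l.
Qed.

Lemma cbounded_cst c : cbounded (fun=> c).
Proof. by split; [exact: cmeasurable_cst|exists (normc c ^+ 2)]. Qed.

Lemma cboundedZ c f : cbounded f -> cbounded (fun x => c * f x).
Proof. exact/cboundedM/cbounded_cst. Qed.

Lemma cboundedB f g : cbounded f -> cbounded g -> cbounded (fun x => f x - g x).
Proof.
move=> bf /(cboundedZ (-1)) bg.
rewrite (_ : (fun x => _) = fun x => f x + -1 * g x); first exact: cboundedD.
by apply/funext => x; rewrite mulN1r.
Qed.

Lemma normc2_conj (z : R[i]) : normc (conjc z) ^+ 2 = normc z ^+ 2.
Proof. by rewrite !normc2E; case: z => a b /=; rewrite sqrrN. Qed.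

Lemma cbounded_conj f : cbounded f -> cbounded (fun x => conjc (f x)).
Proof.
move=> [[mRe mIm] [M fM]]; split; last by exists M => x; rewrite normc2_conj.
split.
  rewrite (_ : (fun x => _) = fun x => complex.Re (f x))//.
  by apply/funext => x; case: (f x).
rewrite (_ : (fun x => _) = fun x => - complex.Im (f x)).
  exact: measurable_funN.
by apply/funext => x; case: (f x).
Qed.

Lemma cbounded_sum (I : Type) (s : seq I) (F : I -> T -> R[i]) :
  (forall i, cbounded (F i)) -> cbounded (fun x => \sum_(i <- s) F i x).
Proof.
move=> bF; elim: s => [|i s IH].
  by under eq_fun do rewrite big_nil; exact: cbounded_cst.
by under eq_fun do rewrite big_cons; exact: cboundedD.
Qed.

Lemma cintD f g : cbounded f -> cbounded g ->
  cint (fun x => f x + g x) = cint f + cint g.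
Proof.
move=> /cbounded_integrable[f1 f2] /cbounded_integrable[g1 g2].
rewrite /cint; under eq_Rintegral do rewrite ReD.
rewrite RintegralD//; under [in X in _ +i* X]eq_Rintegral do rewrite ImD.
by rewrite RintegralD.
Qed.

Lemma cintZ c f : cbounded f -> cint (fun x => c * f x) = c * cint f.
Proof.
move=> /cbounded_integrable[f1 f2].
have iZ (r : R) (g : T -> R) : mu.-integrable D (EFin \o g) ->
    mu.-integrable D (EFin \o (fun x : T => r * g x)).
  move=> ig; rewrite (_ : _ \o _ = fun x => r%:E * (EFin \o g) x)%E//.
  exact: integrableZl.
apply/eqP; rewrite eq_complex ReM ImM /cint /=; apply/andP; split; apply/eqP.
  under eq_Rintegral do rewrite ReM.
  by rewrite RintegralB ?RintegralZl//; exact: iZ.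
under eq_Rintegral do rewrite ImM.
by rewrite RintegralD ?RintegralZl//; exact: iZ.
Qed.

Lemma cint_sum (I : Type) (s : seq I) (F : I -> T -> R[i]) :
  (forall i, cbounded (F i)) ->
  cint (fun x => \sum_(i <- s) F i x) = \sum_(i <- s) cint (F i).
Proof.
move=> bF; elim: s => [|i s IH].
  rewrite big_nil /cint; under eq_Rintegral do rewrite big_nil.
  under [in X in _ +i* X]eq_Rintegral do rewrite big_nil.
  by rewrite /Rintegral integral0.
rewrite big_cons -IH -cintD//; last exact: cbounded_sum.
by congr cint; apply/funext => x; rewrite big_cons.
Qed.

Lemma inner_conj f g : cbounded f -> cbounded g ->
  inner g f = conjc (inner f g).
Proof.
move=> bf bg.
have /cbounded_integrable[_ ifg] := cboundedM bf (cbounded_conj bg).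
rewrite /inner /cint /=; congr (_ +i* _).
  apply: eq_Rintegral => x _; rewrite !ReM.
  by case: (f x) (g x) => [a b] [a' b'] /=; ring.
rewrite -mulN1r -RintegralZl//; apply: eq_Rintegral => x _; rewrite !ImM.
by case: (f x) (g x) => [a b] [a' b'] /=; ring.
Qed.

Lemma innerDl f g h : cbounded f -> cbounded g -> cbounded h ->
  inner (fun x => f x + g x) h = inner f h + inner g h.
Proof.
move=> bf bg /cbounded_conj bh; rewrite /inner -cintD; try exact: cboundedM.
by congr cint; apply/funext => x; rewrite mulrDl.
Qed.

Lemma innerZl c f h : cbounded f -> cbounded h ->
  inner (fun x => c * f x) h = c * inner f h.
Proof.
move=> bf /cbounded_conj bh; rewrite /inner -cintZ; last exact: cboundedM.
by congr cint; apply/funext => x; rewrite mulrA.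
Qed.

Lemma inner_suml (I : Type) (s : seq I) (F : I -> T -> R[i]) c h :
  (forall i, cbounded (F i)) -> cbounded h ->
  inner (fun x => \sum_(i <- s) c i * F i x) h =
  \sum_(i <- s) c i * inner (F i) h.
Proof.
move=> bF bh; rewrite /inner.
under [RHS]eq_bigr do rewrite -/(inner _ _) -innerZl//.
rewrite -cint_sum; last first.
  by move=> i; apply: cboundedM; [exact: cboundedZ|exact: cbounded_conj].
by congr cint; apply/funext => x; rewrite mulr_suml.
Qed.

Lemma inner_sqnorm f : cbounded f ->
  sqnorm mu D f = (complex.Re (inner f f))%:E /\ complex.Im (inner f f) = 0.
Proof.
move=> bf; have /cbounded_integrable[i1 _] := cboundedM bf (cbounded_conj bf).
split; rewrite /inner /cint/=.
  rewrite /Rintegral fineK; last exact: integrable_fin_num.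
  rewrite /sqnorm; apply: eq_integral => x _; congr EFin; rewrite normc2E ReM.
  by case: (f x) => a b /=; ring.
under eq_Rintegral do rewrite ImM.
rewrite /Rintegral (_ : integral _ _ _ = 0%E)//.
apply: integral0_eq => x _; case: (f x) => a b /=; congr EFin; ring.
Qed.

Section orthogonal_family.
Context (K : choiceType) (L : set K) (E : K -> T -> R[i]) (N : R).
Hypothesis DN : mu D = N%:E.
Hypothesis N0 : 0 < N.
Hypothesis mE : forall l, cmeasurable D (E l).
Hypothesis E1 : forall l x, normc (E l x) ^+ 2 = 1.
Hypothesis orthE : forall l m, L l -> L m -> l <> m -> inner (E l) (E m) = 0.

Lemma cbounded_unimodular f : cmeasurable D f ->
  (forall x, normc (f x) ^+ 2 = 1) -> cbounded f.
Proof. by move=> mf f1; split => //; exists 1 => x; rewrite f1. Qed.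

Let bE l : cbounded (E l). Proof. exact: cbounded_unimodular. Qed.

Lemma sqnorm_unimodular f : (forall x, normc (f x) ^+ 2 = 1) ->
  sqnorm mu D f = N%:E.
Proof.
move=> f1; rewrite /sqnorm; under eq_integral do rewrite f1.
by rewrite integral_cst// mul1e.
Qed.

Lemma inner_unimodular f : cmeasurable D f ->
  (forall x, normc (f x) ^+ 2 = 1) -> inner f f = N%:C.
Proof.
move=> mf f1; have [] := inner_sqnorm (cbounded_unimodular mf f1).
rewrite sqnorm_unimodular//; case: (inner f f) => a b /= -[->] ->.
by [].
Qed.

(** Expanding the square of the norm and completing the squares.  The E l have
    square norm N, which accounts for the powers of N; the distance is smallest
    when each c l is the Fourier coefficient inner f (E l) / N. *)
Lemma sqnorm_dist f (s : seq K) (c : K -> R[i]) :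
  cmeasurable D f -> (forall x, normc (f x) ^+ 2 = 1) ->
  uniq s -> (forall l, l \in s -> L l) ->
  (N%:E * sqnorm mu D (fun x => f x - \sum_(l <- s) c l * E l x)%R =
  (N ^+ 2 - \sum_(l <- s) normc (inner f (E l)) ^+ 2
   + \sum_(l <- s) normc (N%:C * c l - inner f (E l)) ^+ 2)%:E)%E.
Proof.
move=> mf f1 us sL; have bf := cbounded_unimodular mf f1.
pose h x := \sum_(l <- s) c l * E l x.
have bh : cbounded h by apply: cbounded_sum => l; exact: cboundedZ.
have [-> _] := inner_sqnorm (cboundedB bf bh).
have normcE (z : R[i]) : (normc z ^+ 2)%:C = z * conjc z.
  by rewrite normc2E; case: z => a b; apply/eqP; rewrite eq_complex /=;
    apply/andP; split; apply/eqP; ring.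
have hh l : l \in s -> inner (E l) h = N%:C * conjc (c l).
  move=> ls; rewrite inner_conj// inner_suml// (bigD1_seq l)//= big_seq_cond.
  rewrite big1 ?addr0 ?inner_unimodular//.
    by rewrite [LHS]rmorphM/= oppr0 mulrC.
  move=> m /andP[ms ml]; rewrite orthE ?mulr0//; [exact: sL|exact: sL|].
  exact/eqP.
have fh : inner f h = \sum_(l <- s) conjc (c l) * inner f (E l).
  rewrite inner_conj// inner_suml// rmorph_sum; apply: eq_bigr => l _.
  by rewrite [in RHS](inner_conj (bE l) bf) [LHS]rmorphM.
have XE : inner (fun x => f x - h x) (fun x => f x - h x) =
    N%:C - (inner f h + inner h f) + inner h h.
  rewrite -mulN1r; have bN := cboundedZ (-1) bh.
  have expand g : cbounded g ->
      inner (fun x => f x - h x) g = inner f g - inner h g.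
    move=> bg; rewrite -mulN1r -innerZl// -innerDl//.
    by under [in RHS]eq_fun do rewrite mulN1r.
  have bfh := cboundedB bf bh.
  rewrite expand// (inner_conj bfh bf)// expand// (inner_conj bfh bh)// expand//.
  have cB (a b : R[i]) : conjc (a - b) = conjc a - conjc b by exact: rmorphB.
  rewrite !cB -!inner_conj// inner_unimodular//; ring.
have [_] := inner_sqnorm (cboundedB bf bh).
move: XE; set X := inner _ _ => XE X0.
have {X0}XR : (complex.Re X)%:C = X by move: X0; case: X {XE} => a b /= ->.
rewrite -EFinM; congr EFin; apply: (@complexI R).
have rM (a b : R) : (a * b)%:C = a%:C * b%:C by exact: rmorphM.
have rB (a b : R) : (a - b)%:C = a%:C - b%:C by exact: rmorphB.
have rD (a b : R) : (a + b)%:C = a%:C + b%:C by exact: rmorphD.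
have rS (F : K -> R) : (\sum_(l <- s) F l)%:C = \sum_(l <- s) (F l)%:C.
  exact: rmorph_sum.
have cS (F : K -> R[i]) :
    conjc (\sum_(l <- s) F l) = \sum_(l <- s) conjc (F l) by exact: rmorph_sum.
rewrite expr2 rD rB !rM !rS XR XE (inner_conj bf bh) fh inner_suml// cS.
rewrite mulrDr mulrBr -!addrA; congr (_ + _).
rewrite mulrDr !mulr_sumr -big_split -!sumrN -!big_split.
rewrite big_seq [RHS]big_seq; apply: eq_bigr => l ls.
rewrite hh// [X in _ = - X + _]normcE [X in _ = _ + X]normcE.
have cM (a b : R[i]) : conjc (a * b) = conjc a * conjc b by exact: rmorphM.
have cB (a b : R[i]) : conjc (a - b) = conjc a - conjc b by exact: rmorphB.
rewrite [X in - (_ + _ * X)]cM cB cM (conjc_real N) conjcK.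
move: (c l) (conjc (c l)) (inner f (E l)) (conjc _) => a b g g' /=; ring.
Qed.

(** Bessel inequality: the square of the distance from f to a projection is
    nonnegative. *)
Lemma bessel f : cmeasurable D f -> (forall x, normc (f x) ^+ 2 = 1) ->
  (\esum_(l in L) (normc (inner f (E l)) ^+ 2)%:E <= (N ^+ 2)%:E)%E.
Proof.
move=> mf f1; apply: ge_ereal_sup => _ [F [finF FL] <-].
rewrite fsbig_finite//= sumEFin.
have sL l : l \in finmap.enum_fset (fset_set F) -> L l.
  by rewrite in_fset_set// inE => /FL.
have := sqnorm_dist (fun l => (N%:C)^-1 * inner f (E l)) mf f1
  (finmap.fset_uniq (fset_set F)) sL.
rewrite [X in _ + X]big1 ?addr0; last first.
  move=> l _; rewrite mulrA divff ?mul1r ?subrr ?normc2E/= ?expr0n ?addr0//.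
  by rewrite eq_complex/= eqxx andbT gt_eqF.
move=> dist; rewrite lee_fin -subr_ge0 -lee_fin -dist.
by rewrite mule_ge0// ?sqnorm_ge0// lee_fin ltW.
Qed.

(** Parseval equality: a combination close to f forces the finite sum over its
    frequencies to be close to N ^ 2, since it does no better than the
    projection. *)
Lemma parseval f : cmeasurable D f -> (forall x, normc (f x) ^+ 2 = 1) ->
  approximable mu D L E f ->
  (\esum_(l in L) (normc (inner f (E l)) ^+ 2)%:E = (N ^+ 2)%:E)%E.
Proof.
move=> mf f1 Lf; apply/eqP; rewrite eq_le bessel//=.
apply/lee_addgt0Pr => e e0.
have [h /span_uniq[s [c [us sL ->]]]] := Lf _ (divr_gt0 e0 N0).
rewrite -(lte_pmul2l (_ : N%:E \is a fin_num) (_ : 0 < N%:E)%E)//.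
rewrite sqnorm_dist// -EFinM mulrCA divff ?gt_eqF// mulr1 lte_fin => dist.
apply: (@le_trans _ _ ((\sum_(l <- s) normc (inner f (E l)) ^+ 2)%:E + e%:E)%E).
  rewrite -EFinD lee_fin -lerBlDl ltW//; apply: le_lt_trans dist.
  by rewrite lerDl; apply: sumr_ge0 => l _; exact: normc2_ge0.
rewrite leeD2r//; apply: esum_ge; exists [set` s]; first by split.
by rewrite -sumEFin fsbig_seq.
Qed.

(** Conversely, when Parseval equality holds, the projections on finite sets of
    frequencies converge to f. *)
Lemma approximable_of_parseval f : cmeasurable D f ->
  (forall x, normc (f x) ^+ 2 = 1) ->
  ((N ^+ 2)%:E <= \esum_(l in L) (normc (inner f (E l)) ^+ 2)%:E)%E ->
  approximable mu D L E f.
Proof.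
move=> mf f1 Nle e e0.
have : ((N ^+ 2 - N * e)%:E < \esum_(l in L) (normc (inner f (E l)) ^+ 2)%:E)%E.
  by apply: lt_le_trans Nle; rewrite lte_fin ltrBlDr ltrDl mulr_gt0.
move=> /ereal_sup_gt[_ [F [finF FL] <-]].
rewrite fsbig_finite//= sumEFin lte_fin => FN.
have sL l : l \in finmap.enum_fset (fset_set F) -> L l.
  by rewrite in_fset_set// inE => /FL.
have := sqnorm_dist (fun l => (N%:C)^-1 * inner f (E l)) mf f1
  (finmap.fset_uniq (fset_set F)) sL.
rewrite [X in _ + X]big1 ?addr0; last first.
  move=> l _; rewrite mulrA divff ?mul1r ?subrr ?normc2E/= ?expr0n ?addr0//.
  by rewrite eq_complex/= eqxx andbT gt_eqF.
move=> dist.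
exists (fun x => \sum_(l <- finmap.enum_fset (fset_set F))
  ((N%:C)^-1 * inner f (E l)) * E l x).
  by exists (finmap.enum_fset (fset_set F)), (fun l => (N%:C)^-1 * inner f (E l)).
rewrite -(lte_pmul2l (_ : N%:E \is a fin_num) (_ : 0 < N%:E)%E)// dist.
by rewrite -EFinM lte_fin ltrBlDr -ltrBlDl.
Qed.

End orthogonal_family.
End complex_integral.

(** * Exponentials on a segment *)

Section exponential_line.
Context (R : realType).
Implicit Types r s t x : R.

(** The character exp(2 i pi r) of the line. *)
Definition ee r : R[i] := cos (2 * pi * r) +i* sin (2 * pi * r).

Lemma eeD r s : ee (r + s) = ee r * ee s.
Proof.
rewrite /ee mulrDr cosD sinD; apply/eqP; rewrite eq_complex ReM ImM/=.
by rewrite [X in _ && (_ == X)]addrC !eqxx.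
Qed.

Lemma conj_ee r : conjc (ee r) = ee (- r).
Proof. by rewrite /ee mulrN cosN sinN. Qed.

Lemma ee0 : ee 0 = 1.
Proof. by rewrite /ee mulr0 cos0 sin0. Qed.

Lemma normc2_ee r : normc (ee r) ^+ 2 = 1.
Proof. by rewrite normc2E/= cos2Dsin2. Qed.

Lemma measurable_cosC d (T : measurableType d) (D : set T) (f : T -> R) :
  measurable_fun D f -> measurable_fun D (fun y => cos (f y)).
Proof.
by apply: measurableT_comp; apply: continuous_measurable_fun; exact: continuous_cos.
Qed.

Lemma measurable_sinC d (T : measurableType d) (D : set T) (f : T -> R) :
  measurable_fun D f -> measurable_fun D (fun y => sin (f y)).
Proof.
by apply: measurableT_comp; apply: continuous_measurable_fun; exact: continuous_sin.
Qed.

Lemma cmeasurable_ee d (T : measurableType d) (D : set T) (f : T -> R) :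
  measurable_fun D f -> cmeasurable D (fun y => ee (f y)).
Proof.
move=> mf; have m2f : measurable_fun D (fun y => 2 * pi * f y).
  exact: measurable_funM.
by split; [exact: measurable_cosC|exact: measurable_sinC].
Qed.

Lemma ee_int (k : int) : ee k%:~R = 1.
Proof.
have ee_nat (n : nat) : ee n%:R = 1.
  elim: n => [|n IH]; first exact: ee0.
  rewrite -addn1 natrD eeD IH mul1r /ee mulr1 mulr_natl cos2pi sin2pi.
  by [].
case: k => n; first exact: ee_nat.
by rewrite NegzE mulrNz -conj_ee ee_nat conjc1.
Qed.

Lemma ee_neq1 r : 0 < `|r| < 1 -> ee r != 1.
Proof.
move=> /andP[r0 r1]; apply/eqP => er.
have {er} c1 : cos (2 * pi * `|r|) = 1.
  by have [_|_] := ger0P r; [|rewrite mulrN cosN]; case: er.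
have s0 : 0 < sin (pi * `|r|).
  apply: sin_gt0_pi; rewrite mulr_gt0 ?pi_gt0//=.
  by rewrite -[ltRHS]mulr1 ltr_pM2l// pi_gt0.
move: c1; rewrite -mulrA mulr_natl cos_mulr2n cos2sin2 => c1.
have : sin (pi * `|r|) ^+ 2 = 0 by lra.
by move/eqP; rewrite sqrf_eq0 gt_eqF.
Qed.

Variables a b : R.
Hypothesis ab : a < b.
Let ell := b - a.
Notation leb := (@lebesgue_measure R).
Let J := `[a, b]%classic : set (measurableTypeR R).

Let mJ : measurable J. Proof. exact: measurable_itv. Qed.

Lemma lebesgue_segment : leb J = ell%:E.
Proof. by rewrite lebesgue_measure_itv/= lte_fin ab -EFinB. Qed.

Let Joo : (leb J < +oo)%E. Proof. by rewrite lebesgue_segment ltry. Qed.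

(** The Fourier transform, at the frequency - r, of the indicator of [a, b]. *)
Definition fwin r : R[i] := cint leb J (fun x => ee (r * x)).

Lemma fwin0 : fwin 0 = ell%:C.
Proof.
rewrite /fwin /cint; under eq_Rintegral do rewrite mul0r ee0/=.
under [X in _ +i* X]eq_Rintegral do rewrite mul0r ee0/=.
rewrite !Rintegral_cst// mul1r mul0r.
by rewrite (_ : fine _ = ell)// [X in fine X](lebesgue_segment).
Qed.

Lemma Rintegral_segment (f F : R -> R) :
  (forall x : R, is_derive x (1 : R) F (f x)) -> continuous f ->
  (\int[leb]_(x in J) f x)%R = F b - F a.
Proof.
move=> dF cf; rewrite /Rintegral (@continuous_FTC2 _ f F)//.
- exact: continuous_subspaceT.
- have cF x : F @ x --> F x.
    by apply: differentiable_continuous; apply/derivable1_diffP; case: (dF x).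
  split; first by move=> x _; case: (dF x).
    by apply: cvg_at_right_filter; exact: cF.
  by apply: cvg_at_left_filter; exact: cF.
- by move=> x _; rewrite derive1E; exact: derive_val.
Qed.

Lemma derive_trig (c x : R) :
  is_derive x (1 : R) (fun y : R => sin (c * y)) (c * cos (c * x)) /\
  is_derive x (1 : R) (fun y : R => - cos (c * y)) (c * sin (c * x)).
Proof.
split.
  rewrite (_ : (fun y => _) = sin \o (fun y => c * y))//.
  by apply: is_derive_eq; rewrite /= scaler1 /GRing.scale/= mulrC.
rewrite (_ : (fun y => _) = - (cos \o (fun y => c * y)))//.
by apply: is_derive_eq; rewrite /= scaler1 /GRing.scale/=; ring.
Qed.

Lemma bounded_trig_integrable (f : R -> R) : continuous f ->
  leb.-integrable J (EFin \o f).
Proof.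
move=> cf; apply: continuous_compact_integrable; first exact: segment_compact.
exact: continuous_subspaceT.
Qed.

Lemma continuous_trig (c : R) : continuous (fun x => cos (c * x)) /\
  continuous (fun x => sin (c * x)).
Proof.
have cm x : {for x, continuous (fun y : R => c * y)}.
  by apply: continuousM; [exact: cst_continuous|exact: cvg_id].
split => x; apply: continuous_comp; first exact: cm.
- exact: continuous_cos.
- exact: cm.
- exact: continuous_sin.
Qed.

(** The fundamental theorem of calculus, multiplied out so that it includes
    r = 0. *)
Lemma fwinE r :
  (2 * pi * r)%:C * fwin r = (sin (2 * pi * (r * b)) - sin (2 * pi * (r * a)))
    +i* (cos (2 * pi * (r * a)) - cos (2 * pi * (r * b))).
Proof.
have [cc cs] := continuous_trig (2 * pi * r).
apply/eqP; rewrite eq_complex ReM ImM/= !mul0r subr0 addr0.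
have E (g : R -> R) : (fun x => g (2 * pi * (r * x))) = (fun x => g (2 * pi * r * x)).
  by apply/funext => x; rewrite !mulrA.
rewrite (E cos) (E sin) -!RintegralZl//; try exact: bounded_trig_integrable.
rewrite (Rintegral_segment (fun x => (derive_trig _ x).1)); last first.
  by move=> x; apply: cvgM; [exact: cvg_cst|exact: cc].
rewrite (Rintegral_segment (fun x => (derive_trig _ x).2)); last first.
  by move=> x; apply: cvgM; [exact: cvg_cst|exact: cs].
by rewrite !mulrA [X in _ && (X == _)]addrC opprK !eqxx.
Qed.

(** Over a whole number of periods the exponential integrates to zero. *)
Lemma fwin_eq0 r (k : int) : r != 0 -> r * ell = k%:~R -> fwin r = 0.
Proof.
move=> r0 rk; have /eqP := fwinE r.
have rb : r * b = r * a + k%:~R by rewrite -rk /ell; ring.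
have [-> ->] : cos (2 * pi * (r * b)) = cos (2 * pi * (r * a)) /\
    sin (2 * pi * (r * b)) = sin (2 * pi * (r * a)).
  by have := eeD (r * a) k%:~R; rewrite ee_int mulr1 -rb => -[].
rewrite !subrr => /eqP; apply: contra_eq => r1.
rewrite mulf_neq0//. rewrite eq_complex /= eqxx andbT !mulf_neq0//.
by rewrite gt_eqF// pi_gt0.
Qed.

(** A zero of fwin would make the exponential take the same value at both ends of
    the segment, over less than one period. *)
Lemma fwin_neq0 r : `|r| * ell < 1 -> fwin r != 0.
Proof.
move=> r1; have [->|r0] := eqVneq r 0.
  by rewrite fwin0 eq_complex/= eqxx andbT gt_eqF// subr_gt0.
apply/eqP => w0; have := fwinE r; rewrite w0 mulr0 => -[/esym/eqP + /esym/eqP].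
rewrite !subr_eq0 => /eqP sE /eqP cE.
have : ee (r * ell) = 1.
  rewrite /ell mulrBr eeD -conj_ee (_ : ee (r * b) = ee (r * a)).
    apply/eqP; rewrite eq_complex ReM ImM/=.
    have := cos2Dsin2 (2 * pi * (r * a)).
    move: (cos _) (sin _) => u v <-.
    by apply/andP; split; apply/eqP; ring.
  by rewrite /ee sE cE.
apply/eqP/ee_neq1; rewrite normrM [`|ell|]gtr0_norm ?subr_gt0//.
by rewrite mulr_gt0 ?normr_gt0 ?subr_gt0.
Qed.

Definition fwin2 r := normc (fwin r) ^+ 2.

Lemma fwin2N r : fwin2 (- r) = fwin2 r.
Proof.
rewrite /fwin2 -(normc2_conj (fwin r)); congr (normc _ ^+ 2).
rewrite /fwin /cint /=; congr (_ +i* _).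
  by apply: eq_Rintegral => x _; rewrite mulNr mulrN cosN.
have [_ cs] := continuous_trig (2 * pi * r).
rewrite -mulN1r -RintegralZl//.
  by apply: eq_Rintegral => x _; rewrite mulNr mulrN sinN mulN1r.
rewrite (_ : _ \o _ = EFin \o (fun x => sin (2 * pi * r * x))).
  exact: bounded_trig_integrable.
by apply/funext => x /=; rewrite !mulrA.
Qed.

(** A parametric integral is measurable by the Tonelli theorem, once 1 is added to
    make the integrand nonnegative. *)
Lemma measurable_fwin2 : measurable_fun (setT : set (measurableTypeR R)) fwin2.
Proof.
have meas (g : R -> R) : continuous g -> (forall x, -1 <= g x) -> (forall x, g x <= 1) ->
    measurable_fun (setT : set (measurableTypeR R))
      (fun r => \int[leb]_(x in J) g (2 * pi * (r * x)))%R.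
  move=> cg gN1 g1.
  pose f (p : measurableTypeR R * measurableTypeR R) : \bar R :=
    ((1 + g (2 * pi * (p.1 * p.2))) * \1_J p.2)%:E.
  have mf : measurable_fun setT f.
    apply/measurable_EFinP; apply: measurable_funM; last first.
      by apply: measurableT_comp => //; exact: measurable_indic.
    apply: measurable_funD => //; apply: measurableT_comp.
      exact: continuous_measurable_fun.
    by apply: measurable_funM => //; exact: measurable_funM.
  have f0 p : (0 <= f p)%E.
    by rewrite lee_fin mulr_ge0// -lerBlDl sub0r.
  have mF : measurable_fun setT (fubini_F leb f).
    exact: measurable_fun_fubini_tonelli_F.
  rewrite (_ : (fun r => _) = fun r => fine (fubini_F leb f r) - ell).
    apply: measurable_funB => //; apply: measurableT_comp mF.
    exact: fine_measurable.
  apply/funext => r.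
  have ig : leb.-integrable J (EFin \o (fun x => g (2 * pi * (r * x)))).
    apply: bounded_trig_integrable => x; apply: continuous_comp; last exact: cg.
    apply: cvgM; first exact: cvg_cst.
    by apply: cvgM; [exact: cvg_cst|exact: cvg_id].
  have i1 : leb.-integrable J (EFin \o (fun=> 1 : R)).
    by apply: bounded_trig_integrable => x; exact: cst_continuous.
  transitivity ((\int[leb]_(x in J) (1 + g (2 * pi * (r * x))))%R - ell).
    rewrite RintegralD// Rintegral_cst// mul1r.
    by rewrite [X in fine X](lebesgue_segment) addrC addKr.
  congr (_ - _); rewrite /Rintegral integral_mkcond /fubini_F; congr fine.
  apply: eq_integral => x _; rewrite /f /patch indicE/=.
  by case: (x \in J); rewrite ?mulr1 ?mulr0.
rewrite /fwin2; under eq_fun do rewrite normc2E.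
apply: measurable_funD; apply: measurable_funX; apply: meas.
- exact: continuous_cos.
- exact: cos_geN1.
- exact: cos_le1.
- exact: continuous_sin.
- exact: sin_geN1.
- exact: sin_le1.
Qed.

End exponential_line.

(** * Completeness of the Fourier basis of a segment *)

Section step_polynomials.
Context (R : realType).
Implicit Types y z : R.

(** On [0, 1] these polynomials converge to the step function with jump at 1/2:
    (1 - y ^ n) ^ (2 ^ n) behaves like exp (- (2 y) ^ n). *)
Definition step_poly (n : nat) y : R := 1 - (1 - y ^+ n) ^+ (2 ^ n).

Lemma step_poly_itv n y : 0 <= y <= 1 -> 0 <= step_poly n y <= 1.
Proof.
move=> /andP[y0 y1]; have yn0 : 0 <= y ^+ n by rewrite exprn_ge0.
have yn1 : y ^+ n <= 1 by rewrite exprn_ile1.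
have z0 : 0 <= (1 - y ^+ n) ^+ (2 ^ n) by rewrite exprn_ge0// subr_ge0.
have z1 : (1 - y ^+ n) ^+ (2 ^ n) <= 1.
  by rewrite exprn_ile1// ?subr_ge0// gerBl.
by rewrite /step_poly; apply/andP; split; lra.
Qed.

Lemma bernoulli_le z m : 0 <= z <= 1 -> 1 - m%:R * z <= (1 - z) ^+ m.
Proof.
move=> /andP[z0 z1]; elim: m => [|m IH]; first by rewrite mul0r subr0 expr0.
rewrite exprS; apply: (@le_trans _ _ ((1 - z) * (1 - m%:R * z))); last first.
  by rewrite ler_wpM2l// subr_ge0.
rewrite -natr1; have : 0 <= m%:R * z ^+ 2 by rewrite mulr_ge0// sqr_ge0.
by nra.
Qed.

Lemma bernoulli_inv_le z m : 0 <= z <= 1 -> (1 - z) ^+ m * (m%:R * z) <= 1.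
Proof.
move=> /andP[z0 z1].
have mz : m%:R * z <= (1 + z) ^+ m.
  elim: m => [|m IH]; first by rewrite mul0r expr0.
  rewrite exprS -natr1 mulrDl mul1r mulrDl mul1r addrC.
  have : 1 <= (1 + z) ^+ m by rewrite exprn_ege1// lerDl.
  by nra.
apply: (@le_trans _ _ ((1 - z) ^+ m * (1 + z) ^+ m)).
  by rewrite ler_wpM2l// exprn_ge0// subr_ge0.
rewrite -exprMn exprn_ile1//; nra.
Qed.

Lemma step_poly_cvg0 y : 0 <= y < 2^-1 -> step_poly ^~ y @ \oo --> (0 : R).
Proof.
move=> /andP[y0 y1].
have y01 : 0 <= y <= 1 by lra.
apply: (@squeeze_cvgr _ _ _ _ (cst 0) (fun n => (2 * y) ^+ n)).
- apply: nearW => n; have /andP[-> _] := step_poly_itv n y01 => /=.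
  rewrite /step_poly exprMn -natrX.
  have := @bernoulli_le (y ^+ n) (2 ^ n)%N.
  by rewrite exprn_ge0 ?exprn_ile1//; [move=> /(_ isT); lra|lra].
- exact: cvg_cst.
- by apply: cvg_expr; rewrite ger0_norm; lra.
Qed.

Lemma step_poly_cvg1 y : 2^-1 < y <= 1 -> step_poly ^~ y @ \oo --> (1 : R).
Proof.
move=> /andP[y0 y1].
have y01 : 0 <= y <= 1 by lra.
apply: (@squeeze_cvgr _ _ _ _ (fun n => 1 - ((2 * y)^-1) ^+ n) (cst 1)).
- apply: nearW => n; have /andP[_ ->] := step_poly_itv n y01.
  rewrite andbT /step_poly lerD2l lerN2 exprVn.
  have y2 : 0 < (2 * y) ^+ n by rewrite exprn_gt0//; lra.
  rewrite -[leRHS]mul1r ler_pdivlMr// exprMn -natrX.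
  by apply: bernoulli_inv_le; rewrite exprn_ge0 ?exprn_ile1//; lra.
- rewrite -[X in _ --> X]subr0; apply: cvgB; first exact: cvg_cst.
  apply: cvg_expr; rewrite ger0_norm ?invr_ge0; last lra.
  by rewrite invf_lt1; lra.
- exact: cvg_cst.
Qed.

End step_polynomials.

Section fourier_complete.
Context (R : realType).
Variables a b : R.
Hypothesis ab : a < b.
Let ell := b - a.
Notation leb := (@lebesgue_measure R).
Let J := `[a, b]%classic : set (measurableTypeR R).
Let E1 (t x : R) : R[i] := ee (t * x).

(** The dual lattice of the period b - a. *)
Definition freq : set R := [set t | exists k : int, t * (b - a) = k%:~R].

Let ell0 : 0 < ell. Proof. by rewrite subr_gt0. Qed.

Let spanR (p : R -> R) := span freq E1 (fun x => (p x)%:C).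

Let spanM f g : span freq E1 f -> span freq E1 g -> span freq E1 (fun x => f x * g x).
Proof.
move=> sf sg; move: f sf; apply: span_ind.
- by under eq_fun do rewrite mul0r; exact: span0.
- by move=> f f' sf sf'; under eq_fun do rewrite mulrDl; exact: spanD.
move=> c t [k tk]; move: g sg; apply: span_ind.
- by under eq_fun do rewrite mulr0; exact: span0.
- by move=> f f' sf sf'; under eq_fun do rewrite mulrDr; exact: spanD.
move=> c' t' [k' tk'].
rewrite (_ : (fun x => _) = fun x => (c * c') * E1 (t + t') x).
  apply: spanZ; apply: span_mem; exists (k + k').
  by rewrite mulrDl tk tk' -intrD.
by apply/funext => x; rewrite /E1 mulrDl eeD mulrACA.
Qed.

Let span1 : spanR (fun=> 1).
Proof.
rewrite /spanR (_ : (fun x => _) = E1 0).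
  by apply: span_mem; exists 0; rewrite mul0r.
by apply/funext => x; rewrite /E1 mul0r ee0.
Qed.

Let spanRM p q : spanR p -> spanR q -> spanR (fun x => p x * q x).
Proof.
move=> sp sq; rewrite /spanR (_ : (fun x => _) = fun x => (p x)%:C * (q x)%:C).
  exact: spanM.
by apply/funext => x; rewrite -rmorphM.
Qed.

Let spanRZ (c : R) p : spanR p -> spanR (fun x => c * p x).
Proof.
move=> sp; rewrite /spanR (_ : (fun x => _) = fun x => c%:C * (p x)%:C).
  exact: spanZ.
by apply/funext => x; rewrite -rmorphM.
Qed.

Let spanRD p q : spanR p -> spanR q -> spanR (fun x => p x + q x).
Proof.
move=> sp sq; rewrite /spanR (_ : (fun x => _) = fun x => (p x)%:C + (q x)%:C).
  exact: spanD.
by apply/funext => x; rewrite -rmorphD.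
Qed.

Let spanRX p n : spanR p -> spanR (fun x => p x ^+ n).
Proof.
move=> sp; elim: n => [|n IH]; first by under eq_fun do rewrite expr0.
by under eq_fun do rewrite exprS; exact: spanRM.
Qed.

Let spanR_step p n : spanR p -> spanR (fun x => step_poly n (p x)).
Proof.
move=> sp; rewrite /step_poly.
have spanR1B q : spanR q -> spanR (fun x => 1 - q x).
  move=> sq; under eq_fun do rewrite -mulN1r; apply: spanRD => //.
  exact: spanRZ.
by apply/spanR1B/spanRX/spanR1B/spanRX.
Qed.

(** As a function of x it is a trigonometric polynomial of degree one that
    vanishes at a and beta, so that on the period ]a, b[ its sign distinguishes
    the two arcs with these ends. *)
Definition arc_poly (beta x : R) : R :=
  sin (pi * (x - a) / (b - a)) * sin (pi * (beta - x) / (b - a)).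

Let spanR_arc beta : spanR (arc_poly beta).
Proof.
(* the midpoint of a and beta, in periods; product-to-sum formula *)
pose g := (a + beta) / (2 * ell).
have -> : arc_poly beta = fun x =>
    2^-1 * cos (2 * pi * (ell^-1 * x - g)) +
    (- (2^-1 * cos (pi * (beta - a) / ell))) * 1.
  apply/funext => x.
  have -> : 2 * pi * (ell^-1 * x - g) =
      pi * (x - a) / ell - pi * (beta - x) / ell.
    by rewrite /g; field; rewrite gt_eqF.
  have -> : pi * (beta - a) / ell =
      pi * (x - a) / ell + pi * (beta - x) / ell by ring.
  by rewrite cosB cosD /arc_poly -/ell; field.
apply: spanRD; last exact: spanRZ.
apply: spanRZ; rewrite /spanR (_ : (fun x => _) = fun x =>
    2^-1%:C * ee (- g) * E1 ell^-1 x + 2^-1%:C * ee g * E1 (- ell^-1) x).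
  apply: spanD; apply: spanZ; apply: span_mem.
    by exists 1; rewrite mulVf ?gt_eqF.
  by exists (-1); rewrite mulNr mulVf ?gt_eqF.
apply/funext => x; rewrite -[_ * ee (- g) * _]mulrA -[_ * ee g * _]mulrA -mulrDr /E1 -!eeD.
rewrite [- g + _]addrC (_ : g + _ = - (ell^-1 * x - g)); last by ring.
rewrite -conj_ee /ee; apply/eqP; rewrite eq_complex ReM ImM /=.
by apply/andP; split; apply/eqP; field.
Qed.

Lemma arc_poly_gt0 beta x : beta <= b -> a < x < beta -> 0 < arc_poly beta x.
Proof.
move=> bb /andP[ax xb]; apply: mulr_gt0; apply: sin_gt0_pi.
  rewrite divr_gt0 ?mulr_gt0 ?pi_gt0 ?subr_gt0//=.
  by rewrite ltr_pdivrMr// ltr_pM2l ?pi_gt0// ltrD2r; lra.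
rewrite divr_gt0 ?mulr_gt0 ?pi_gt0 ?subr_gt0//=.
by rewrite ltr_pdivrMr// ltr_pM2l ?pi_gt0//; lra.
Qed.

Lemma arc_poly_lt0 beta x : a < beta -> beta < x < b -> arc_poly beta x < 0.
Proof.
move=> abeta /andP[bx xb]; rewrite /arc_poly pmulr_rlt0.
  rewrite -oppr_gt0 -sinN -mulNr -mulrN opprB; apply: sin_gt0_pi.
  rewrite divr_gt0 ?mulr_gt0 ?pi_gt0 ?subr_gt0//=.
  by rewrite ltr_pdivrMr// ltr_pM2l ?pi_gt0//; lra.
apply: sin_gt0_pi; rewrite divr_gt0 ?mulr_gt0 ?pi_gt0 ?subr_gt0//=; last lra.
by rewrite ltr_pdivrMr// ltr_pM2l ?pi_gt0//; lra.
Qed.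

Lemma arc_poly_itv beta x : -1 <= arc_poly beta x <= 1.
Proof.
rewrite -ler_norml normrM -[leRHS]mulr1; apply: ler_pM => //; exact: sin_max.
Qed.

Let mJ : measurable J. Proof. exact: measurable_itv. Qed.

Let mE1 t : freq t -> cmeasurable J (E1 t).
Proof. by move=> _; apply: cmeasurable_ee; exact: measurable_funM. Qed.

(** The trigonometric polynomials step_poly n ((1 + arc_poly beta) / 2) are bounded
    and converge to the indicator of the arc, except at a, beta and b. *)
Let approximable_arc beta : a < beta <= b ->
  approximable leb J freq E1 (cindic R `]-oo, beta[%classic).
Proof.
move=> /andP[abeta bb].
pose p n (x : R) := step_poly n (2^-1 * (1 + arc_poly beta x)).
have sp n : spanR (p n).
  by apply: spanR_step; apply: spanRZ; apply: spanRD => //; exact: spanR_arc.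
have y01 x : 0 <= 2^-1 * (1 + arc_poly beta x) <= 1.
  by have := arc_poly_itv beta x; lra.
pose A := `]-oo, beta[%classic : set R.
have mp n : measurable_fun J (p n) by have [] := cmeasurable_span mE1 (sp n).
have mA : measurable_fun J (\1_A : R -> R).
  by apply: measurable_funTS; apply: measurable_indic; exact: measurable_itv.
have mf n : measurable_fun J (fun x => ((\1_A x - p n x) ^+ 2)%:E).
  by apply/measurable_EFinP; apply: measurable_funX; exact: measurable_funB.
have [||||_ _] := @dominated_convergence _ _ _ leb J mJ
    (fun n x => ((\1_A x - p n x) ^+ 2)%:E) (cst 0%E) (cst 1%E) mf.
- exact: measurable_cst.
- exists ([set a] `|` [set beta] `|` [set b]); split.
  + by apply: measurableU; [apply: measurableU|]; exact: measurable_set1.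
  + apply: null_set_setU; [by apply: measurableU; exact: measurable_set1|
      exact: measurable_set1| |exact: lebesgue_measure_set1].
    by apply: null_set_setU; [exact: measurable_set1|exact: measurable_set1
      |exact: lebesgue_measure_set1|exact: lebesgue_measure_set1].
  + move=> x; apply: contra_notP => /not_orP[/not_orP[xa xbeta] xb].
    rewrite /J /= in_itv/= => /andP[].
    rewrite !le_eqVlt => /orP[/eqP/esym//|ax] /orP[/eqP//|xlb].
    apply: cvg_EFin; first exact: nearW.
    rewrite /= (_ : 0 = (\1_A x - \1_A x) ^+ 2 :> R); last by rewrite subrr expr0n.
    have cvgp : (fun n => p n x) @ \oo --> (\1_A x : R).
      have [xbt|bx|//] := ltgtP x beta.
        rewrite indicE mem_set ?/A/= ?in_itv//=; apply: step_poly_cvg1.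
        by have := arc_poly_gt0 bb (x := x); have := arc_poly_itv beta x; rewrite ax xbt => + /(_ isT); lra.
      rewrite indicE memNset; last by rewrite /A/= in_itv/= ltNge ltW.
      apply: step_poly_cvg0.
      by have := arc_poly_lt0 abeta (x := x); have := arc_poly_itv beta x; rewrite bx xlb => + /(_ isT); lra.
    by apply: cvgM; apply: cvgB => //; exact: cvg_cst.
- apply/integrableP; split; first exact: measurable_cst.
  under eq_integral do rewrite gee0_abs//.
  by rewrite integral_cst// mul1e [X in (X < _)%E](lebesgue_segment ab) ltry.
- apply: aeW => x n Jx; rewrite gee0_abs ?lee_fin ?sqr_ge0//.
  have := step_poly_itv n (y01 x); rewrite -/(p n x) indicE => /andP[].
  by case: (_ \in _) => /=; nra.
rewrite integral0 => cvg0 e e0.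
have /cvg0[n _ /(_ n (leqnn n)) /= ne] :
    nbhs (0%E : \bar R) [set x | (x < e%:E)%E].
  exact: (@open_ereal_lt_ereal R e%:E 0%E).
exists (fun x => (p n x)%:C); first exact: sp.
apply: le_lt_trans ne; rewrite le_eqVlt; apply/orP; left; apply/eqP.
by apply: eq_integral => x _; rewrite -rmorphB normc2_real.
Qed.

(** Half-lines generate the Borel sets, and a half-line meets [a, b] in the empty
    set, in an arc that starts at a, or in all of it. *)
Lemma fourier_complete A : measurable A ->
  approximable leb J freq E1 (cindic R A).
Proof.
apply: (@approximable_indic _ _ _ leb J mJ _ freq E1 mE1 (@RGenInftyO.G R)).
- by rewrite [X in (X < _)%E](lebesgue_segment ab) ltry.
- exact: RGenInftyO.measurableE.
- move=> _ _ [x ->] [y ->]; exists (Num.min x y).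
  apply/seteqP; split => z /=; rewrite !in_itv/= lt_min; last by move=> /andP[].
  by move=> [-> ->].
- apply: span_approximable; rewrite (_ : cindic _ _ = fun=> 1%:C) //.
  by apply/funext => x; rewrite /cindic indicT.
- move=> _ [beta ->]; have [ba|abeta] := leP beta a.
    apply: (@approximable_eq _ _ _ _ _ _ _ _ (fun=> 0)); last first.
      by apply: span_approximable; exact: span0.
    move=> x; rewrite inE /J/= in_itv/= => /andP[ax _]; rewrite /cindic indicE.
    by rewrite memNset//= in_itv/= ltNge (le_trans ba).
  have [bb|bb] := leP beta b; first by apply: approximable_arc; rewrite abeta.
  apply: (@approximable_eq _ _ _ _ _ _ _ _ (fun=> 1)); last first.
    exact: span_approximable.
  move=> x; rewrite inE /J/= in_itv/= => /andP[_ xb]; rewrite /cindic indicE.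
  by rewrite mem_set//= in_itv/= (le_lt_trans xb).
Qed.

End fourier_complete.

(** * Countable sums, and the total mass of the window *)

Section countable_sums.
Context d (T : measurableType d) (R : realType).
Variables (mu : {measure set T -> \bar R}) (D : set T).
Hypothesis mD : measurable D.
Context (K : choiceType) (L : set K).
Hypothesis cL : countable L.

Lemma countable_nat_enum : L !=set0 ->
  exists (B : set nat) (g : nat -> K), [/\ set_inj B g & g @` B = L].
Proof.
move=> [l0 Ll0]; have /countable_injP[f finj] := cL.
pose g n := xget l0 [set l | L l /\ f l = n].
have gf l : L l -> g (f l) = l.
  move=> Ll; rewrite /g; case: xgetP => [m _ [Lm fm]|/(_ l)/not_andP[]//].
  by apply: finj => //; exact: mem_set.
exists (f @` L), g; split.
  move=> n m; rewrite !inE => -[l Ll <-] [k Lk <-]; rewrite !gf// => ->.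
  by [].
apply/seteqP; split => [_ [_ [l Ll <-] <-]|l Ll]; first by rewrite gf.
by exists (f l); [exists l|rewrite gf].
Qed.

Lemma esum_nneseries (B : set nat) (g : nat -> K) (a : K -> \bar R) :
  set_inj B g -> g @` B = L -> (forall l, 0 <= a l)%E ->
  \esum_(l in L) a l = (\sum_(n <oo) (if n \in B then a (g n) else 0))%E.
Proof.
move=> ginj <- a0; rewrite esum_image// esum_mkcond nneseries_esumT//.
by move=> n; case: ifP.
Qed.

Lemma integral_esum (F : K -> T -> \bar R) :
  (forall l, measurable_fun D (F l)) -> (forall l x, 0 <= F l x)%E ->
  (\int[mu]_(x in D) (\esum_(l in L) F l x) =
   \esum_(l in L) (\int[mu]_(x in D) F l x))%E.
Proof.
move=> mF F0; have [L0|/set0P/countable_nat_enum[B [g [ginj gB]]]] := eqVneq L set0.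
  by rewrite L0 esum_set0 integral0_eq// => x _; rewrite esum_set0.
under eq_integral do rewrite (esum_nneseries ginj gB)//.
rewrite (esum_nneseries ginj gB)//; last by move=> l; exact: integral_ge0.
rewrite integral_nneseries//.
- by apply: eq_eseriesr => n _; case: ifP => // _; rewrite integral0.
- by move=> n; case: (n \in B) => //; exact: measurable_cst.
- by move=> n x _; case: ifP.
Qed.

Lemma esumZr (a : K -> \bar R) (c : R) :
  (forall l, 0 <= a l)%E -> 0 <= c ->
  ((\esum_(l in L) a l) * c%:E = \esum_(l in L) (a l * c%:E))%E.
Proof.
move=> a0 c0.
have [L0|/set0P/countable_nat_enum[B [g [ginj gB]]]] := eqVneq L set0.
  by rewrite L0 !esum_set0 mul0e.
rewrite !(esum_nneseries ginj gB)//; last first.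
  by move=> l; rewrite mule_ge0// lee_fin.
rewrite muleC -nneseriesZl//; last by move=> n _; case: ifP.
by apply: eq_eseriesr => n _; case: ifP; rewrite muleC// mul0e.
Qed.

Lemma measurable_esum (F : K -> T -> \bar R) :
  (forall l, measurable_fun D (F l)) -> (forall l x, 0 <= F l x)%E ->
  measurable_fun D (fun x => \esum_(l in L) F l x).
Proof.
move=> mF F0; have [L0|/set0P/countable_nat_enum[B [g [ginj gB]]]] := eqVneq L set0.
  by rewrite L0; under eq_fun do rewrite esum_set0; exact: measurable_cst.
under eq_fun do rewrite (esum_nneseries ginj gB)//.
apply: ge0_emeasurable_sum => [n x _ _|n _]; first by case: ifP.
by case: (n \in B) => //; exact: measurable_cst.
Qed.

End countable_sums.

Section translation.
Context (R : realType).
Notation leb := (@lebesgue_measure R).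

Lemma ge0_integral_shift (g : measurableTypeR R -> \bar R) (c : R) :
  measurable_fun setT g -> (forall x, 0 <= g x)%E ->
  (\int[leb]_x g (x + c)%R = \int[leb]_x g x)%E.
Proof.
move=> mg g0.
pose phi (x : measurableTypeR R) : measurableTypeR R := x + c.
have mphi : measurable_fun setT phi by exact: measurable_funD.
rewrite [LHS](_ : _ = \int[leb]_(x in phi @^-1` setT) (g \o phi) x)%E; last first.
  by rewrite preimage_setT.
rewrite -ge0_integral_pushforward//.
apply: eq_measure_integral => A mA _; apply/esym.
apply: lebesgue_measure_unique => // _ [[u v] _ <-].
rewrite /= /pushforward (_ : phi @^-1` _ = `]u - c, v - c]%classic).
  by rewrite !lebesgue_measure_itv/= !lte_fin ltrD2r -!EFinB opprB addrA subrK.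
by apply/seteqP; split => x /=; rewrite !in_itv/= /phi ltrBlDr lerBrDr.
Qed.

End translation.

Section window_bound.
Context (R : realType).
Variables a b : R.
Hypothesis ab : a < b.
Notation leb := (@lebesgue_measure R).
Let p := (b - a)^-1.

Let p0 : 0 < p. Proof. by rewrite invr_gt0 subr_gt0. Qed.

Lemma inner_ee (s t : R) : inner leb `[a, b]%classic
  (fun x => ee (s * x)) (fun x => ee (t * x)) = fwin a b (s - t).
Proof.
rewrite /inner /fwin; congr cint; apply/funext => x.
by rewrite conj_ee -eeD mulrBl.
Qed.

(** Bessel inequality for the Fourier basis of [a, b], applied to the exponential
    of frequency v. *)
Lemma bessel_window v :
  (\esum_(k in [set: int]) (fwin2 a b (v - k%:~R * p))%:E <= ((b - a) ^+ 2)%:E)%E.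
Proof.
have ell0 : 0 < b - a by rewrite subr_gt0.
have := @bessel _ (measurableTypeR R) R leb `[a, b]%classic _ _ _ setT
  (fun (k : int) x => ee (k%:~R * p * x)) (b - a) _ ell0 _ _ _ (fun x => ee (v * x)).
under [X in _ -> _ -> (X <= _)%E]eq_esum do rewrite inner_ee.
apply.
- exact: measurable_itv.
- by rewrite [X in (X < _)%E](lebesgue_segment ab) ltry.
- exact: lebesgue_segment.
- by move=> k; apply: cmeasurable_ee; exact: measurable_funM.
- by move=> k x; rewrite normc2_ee.
- move=> k l _ _ kl; rewrite inner_ee; apply: (@fwin_eq0 _ _ _ ab _ (k - l)).
    rewrite -mulrBl mulf_neq0//; last by rewrite gt_eqF.
    by rewrite -intrB intr_eq0 subr_eq0; exact/eqP.
  by rewrite -mulrBl -mulrA mulVf ?gt_eqF// mulr1 intrB.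
- by apply: cmeasurable_ee; exact: measurable_funM.
- by move=> x; rewrite normc2_ee.
Qed.

(** The translates of a fundamental domain tile the line, so the integral of
    fwin2 is the integral over one period of its periodization, which the
    Bessel inequality bounds. *)
Lemma integral_fwin2_le :
  (\int[leb]_x (fwin2 a b x)%:E <= (b - a)%:E)%E.
Proof.
have ell0 : 0 < b - a by rewrite subr_gt0.
pose I0 := `[0, p[%classic : set (measurableTypeR R).
have mI0 : measurable I0 by exact: measurable_itv.
pose G (k : int) (v : measurableTypeR R) : \bar R :=
  ((\1_I0 v) * fwin2 a b (v - k%:~R * p))%:E.
have mG k : measurable_fun setT (G k).
  apply/measurable_EFinP; apply: measurable_funM; first exact: measurable_indic.
  by apply: measurableT_comp; [exact: measurable_fwin2|exact: measurable_funB].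
have G0 k v : (0 <= G k v)%E.
  by rewrite lee_fin mulr_ge0// sqr_ge0.
have -> : (\int[leb]_x (fwin2 a b x)%:E =
    \int[leb]_x (\esum_(k in [set: int]) G k (x + k%:~R * p)%R))%E.
  apply: eq_integral => x _.
  (* the only translate of x that falls in the fundamental domain *)
  pose k0 : int := - Num.floor (x / p).
  have k0P k : \1_I0 (x + k%:~R * p) = (k == k0)%:R :> R.
    rewrite indicE; congr (nat_of_bool _)%:R; apply/idP/idP.
      rewrite inE /I0/= in_itv/= => /andP[h1 h2]; rewrite /k0 -eqr_oppLR.
      rewrite eq_sym; apply/eqP; apply: floor_def.
      rewrite ler_pdivlMr// ltr_pdivrMr// mulrNz mulNr intrD mulrDl mulrNz mulNr mul1r.
      by apply/andP; split; lra.
    move=> /eqP ->; rewrite inE /I0/= in_itv/= /k0 mulrNz mulNr.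
    have := floor_itv (x / p).
    by rewrite ler_pdivlMr// ltr_pdivrMr// intrD mulrDl mul1r => /andP[? ?]; apply/andP; split; lra.
  rewrite (esumID [set k0])//.
  rewrite setTI esum_set1; last exact: G0.
  rewrite esum1 ?adde0.
    by rewrite /G k0P eqxx mul1r addrK.
  by move=> k [_ /= /eqP kk0]; rewrite /G k0P (negbTE kk0) mul0r.
rewrite integral_esum//; last 2 first.
- exact: countableP.
- by move=> k; apply: measurableT_comp; [exact: mG|exact: measurable_funD].
under eq_esum do rewrite ge0_integral_shift//.
rewrite -integral_esum//; last exact: countableP.
apply: (@le_trans _ _ (\int[leb]_x (((b - a) ^+ 2) * \1_I0 x)%:E)%E).
  apply: ge0_le_integral => //.
  - by move=> x _; apply: esum_ge0 => k _; exact: G0.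
  - by apply: measurable_esum => //; exact: countableP.
  - apply/measurable_EFinP; exact: measurable_funM.
  - move=> x _; rewrite indicE; have [xI|xI] := boolP (x \in I0).
      rewrite mulr1; apply: le_trans (bessel_window x).
      by apply: le_esum => k _; rewrite /G indicE xI mul1r.
    rewrite mulr0 esum1// => k _.
    by rewrite /G indicE (negbTE xI) mul0r.
under eq_integral do rewrite EFinM.
rewrite ge0_integralZl//; last 2 first.
- by apply/measurable_EFinP; exact: measurable_indic.
- by rewrite lee_fin sqr_ge0.
rewrite integral_indic// setIT [X in (_ * X)%E](_ : _ = p%:E).
  by rewrite -EFinM lee_fin expr2 -mulrA mulfV ?gt_eqF// mulr1.
by rewrite [LHS]lebesgue_measure_itv/= lte_fin p0 -EFinB subr0.
Qed.

End window_bound.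

(** * Products *)

Section product_domain.
Context d1 d2 (X : measurableType d1) (Y : measurableType d2) (R : realType).
Variables (m1 : {sigma_finite_measure set X -> \bar R}).
Variables (m2 : {sigma_finite_measure set Y -> \bar R}).
Variables (D1 : set X) (D2 : set Y).
Hypotheses (mD1 : measurable D1) (mD2 : measurable D2).
Notation m12 := (m1 \x m2)%E.

Lemma measurable_domainX : measurable (D1 `*` D2).
Proof. exact: measurableX. Qed.

Lemma measurable_fun_fstX d3 (Z : measurableType d3) (f : X -> Z) :
  measurable_fun D1 f -> measurable_fun (D1 `*` D2) (f \o fst).
Proof.
move=> mf; apply: (measurable_comp mD1) => //; last exact: measurable_funTS.
by move=> _ [[x y] [? ?] <-].
Qed.

Lemma measurable_fun_sndX d3 (Z : measurableType d3) (f : Y -> Z) :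
  measurable_fun D2 f -> measurable_fun (D1 `*` D2) (f \o snd).
Proof.
move=> mf; apply: (measurable_comp mD2) => //; last exact: measurable_funTS.
by move=> _ [[x y] [? ?] <-].
Qed.

Lemma ge0_integralX (f : X * Y -> \bar R) :
  measurable_fun (D1 `*` D2) f -> (forall z, (D1 `*` D2) z -> 0 <= f z)%E ->
  (\int[m12]_(z in D1 `*` D2) f z =
   \int[m1]_(x in D1) \int[m2]_(y in D2) f (x, y))%E.
Proof.
move=> mf f0; rewrite integral_mkcond fubini_tonelli1.
- rewrite [RHS]integral_mkcond; apply: eq_integral => x _.
  rewrite /fubini_F patchE; case: ifPn => xD1.
    rewrite [RHS]integral_mkcond; apply: eq_integral => y _.
    by rewrite !patchE in_setX/= xD1.
  by rewrite integral0_eq// => y _; rewrite patchE in_setX/= (negbTE xD1).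
- by apply/(measurable_restrictT _ _).1 => //; exact: measurable_domainX.
- by move=> z; rewrite patchE; case: ifPn => // /set_mem /f0.
Qed.

Lemma measurable_sectionX (f : X * Y -> \bar R) :
  measurable_fun (D1 `*` D2) f -> (forall z, (D1 `*` D2) z -> 0 <= f z)%E ->
  measurable_fun D1 (fun x => \int[m2]_(y in D2) f (x, y))%E.
Proof.
move=> mf f0; pose F := fubini_F m2 (f \_ (D1 `*` D2)).
apply: (@eq_measurable_fun _ _ _ _ _ F).
  move=> x xD1; rewrite /F /fubini_F [RHS]integral_mkcond; apply: eq_integral => y _.
  by rewrite !patchE in_setX/= xD1.
apply: measurable_funTS; apply: measurable_fun_fubini_tonelli_F.
- by apply/(measurable_restrictT _ _).1 => //; exact: measurable_domainX.
- by move=> z; rewrite patchE; case: ifPn => // /set_mem /f0.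
Qed.

Definition tensor (f : X -> R[i]) (g : Y -> R[i]) (z : X * Y) : R[i] :=
  f z.1 * g z.2.

Lemma cmeasurable_tensor f g : cmeasurable D1 f -> cmeasurable D2 g ->
  cmeasurable (D1 `*` D2) (tensor f g).
Proof.
move=> [f1 f2] [g1 g2]; apply: cmeasurableM.
  by split; [exact: (measurable_fun_fstX f1)|exact: (measurable_fun_fstX f2)].
by split; [exact: (measurable_fun_sndX g1)|exact: (measurable_fun_sndX g2)].
Qed.

Lemma sqnorm_tensor f g : cmeasurable D1 f -> cmeasurable D2 g ->
  sqnorm m12 (D1 `*` D2) (tensor f g) = (sqnorm m1 D1 f * sqnorm m2 D2 g)%E.
Proof.
move=> mf mg; rewrite /sqnorm ge0_integralX//; last 2 first.
- by apply: emeasurable_normc2; exact: cmeasurable_tensor.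
- by move=> z _; rewrite lee_fin normc2_ge0.
transitivity (\int[m1]_(x in D1) ((normc (f x) ^+ 2)%:E *
    \int[m2]_(y in D2) (normc (g y) ^+ 2)%:E))%E.
  apply: eq_integral => x _; rewrite -ge0_integralZl//.
  - by apply: eq_integral => y _; rewrite /tensor normc2M EFinM.
  - exact: emeasurable_normc2.
  - by move=> y _; rewrite lee_fin normc2_ge0.
  - by rewrite lee_fin normc2_ge0.
rewrite ge0_integralZr//.
- exact: emeasurable_normc2.
- by move=> x _; rewrite lee_fin normc2_ge0.
- exact: sqnorm_ge0.
Qed.

Hypotheses (D1oo : (m1 D1 < +oo)%E) (D2oo : (m2 D2 < +oo)%E).

Lemma measure_domainX : m12 (D1 `*` D2) = (m1 D1 * m2 D2)%E.
Proof. exact: product_measure1E. Qed.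

Lemma finite_domainX : (m12 (D1 `*` D2) < +oo)%E.
Proof. by rewrite measure_domainX lte_mul_pinfty// ge0_fin_numE. Qed.

Lemma cbounded_tensor f g : cbounded D1 f -> cbounded D2 g ->
  cbounded (D1 `*` D2) (tensor f g).
Proof.
move=> [mf [M fM]] [mg [N gN]]; split; first exact: cmeasurable_tensor.
exists (M * N) => z; rewrite normc2M.
by apply: ler_pM => //; exact: normc2_ge0.
Qed.

Lemma Rintegral_tensor (u : X -> R) (v : Y -> R) :
  m1.-integrable D1 (EFin \o u) -> m2.-integrable D2 (EFin \o v) ->
  m12.-integrable (D1 `*` D2) (fun z => (u z.1 * v z.2)%:E) ->
  (\int[m12]_(z in D1 `*` D2) (u z.1 * v z.2))%R =
  (\int[m1]_(x in D1) u x)%R * (\int[m2]_(y in D2) v y)%R.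
Proof.
move=> iu iv iuv.
rewrite /Rintegral -fineM; try exact: integrable_fin_num.
congr fine; rewrite integral_mkcond -integral12_prod_meas1; last first.
  by apply/(integrable_mkcond _ _).1 => //; exact: measurable_domainX.
transitivity (\int[m1]_(x in D1) ((u x)%:E * \int[m2]_(y in D2) (v y)%:E))%E.
  rewrite [RHS]integral_mkcond; apply: eq_integral => x _.
  rewrite /fubini_F patchE; case: ifPn => xD1.
    rewrite -integralZl// [RHS]integral_mkcond; apply: eq_integral => y _.
    by rewrite !patchE in_setX/= xD1.
  by rewrite integral0_eq// => y _; rewrite patchE in_setX/= (negbTE xD1).
have /fineK <- := integrable_fin_num mD2 iv.
by rewrite integralZr.
Qed.

Lemma cint_tensor f g : cbounded D1 f -> cbounded D2 g ->
  cint m12 (D1 `*` D2) (tensor f g) = cint m1 D1 f * cint m2 D2 g.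
Proof.
move=> bf bg.
have [f1 f2] := cbounded_integrable mD1 D1oo bf.
have [g1 g2] := cbounded_integrable mD2 D2oo bg.
have [mf [M fM]] := bf; have [mg [N gN]] := bg.
have ireal (h : X -> R) (k : Y -> R) :
    measurable_fun D1 h -> measurable_fun D2 k ->
    (forall x, h x ^+ 2 <= normc (f x) ^+ 2) ->
    (forall y, k y ^+ 2 <= normc (g y) ^+ 2) ->
    m12.-integrable (D1 `*` D2) (EFin \o (fun z => h z.1 * k z.2)).
  move=> mh mk hf kg.
  suff : cbounded (D1 `*` D2) (tensor (fun x => (h x)%:C) (fun y => (k y)%:C)).
    move=> /(cbounded_integrable measurable_domainX finite_domainX)[+ _].
    rewrite (_ : _ \o _ = EFin \o (fun z : X * Y => h z.1 * k z.2))//.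
    by apply/funext => z; rewrite /comp /tensor ReM /= mulr0 subr0.
  apply: cbounded_tensor; split; try exact: cmeasurable_real.
  - by exists M => x; rewrite normc2_real (le_trans (hf x)).
  - by exists N => y; rewrite normc2_real (le_trans (kg y)).
have [[mf1 mf2] [mg1 mg2]] := (mf, mg).
have Re2 (z : R[i]) : complex.Re z ^+ 2 <= normc z ^+ 2.
  by rewrite normc2E lerDl sqr_ge0.
have Im2 (z : R[i]) : complex.Im z ^+ 2 <= normc z ^+ 2.
  by rewrite normc2E lerDr sqr_ge0.
have i11 := ireal _ _ mf1 mg1 (fun x => Re2 _) (fun y => Re2 _).
have i12 := ireal _ _ mf1 mg2 (fun x => Re2 _) (fun y => Im2 _).
have i21 := ireal _ _ mf2 mg1 (fun x => Im2 _) (fun y => Re2 _).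
have i22 := ireal _ _ mf2 mg2 (fun x => Im2 _) (fun y => Im2 _).
have mD := measurable_domainX.
apply/eqP; rewrite eq_complex ReM ImM /cint /=; apply/andP; split; apply/eqP.
  under [in LHS]eq_Rintegral do rewrite /tensor ReM.
  by rewrite RintegralB// (Rintegral_tensor f1 g1 i11) (Rintegral_tensor f2 g2 i22).
under [in LHS]eq_Rintegral do rewrite /tensor ImM.
by rewrite RintegralD// (Rintegral_tensor f1 g2 i12) (Rintegral_tensor f2 g1 i21).
Qed.

Lemma inner_tensor f f' g g' :
  cbounded D1 f -> cbounded D1 f' -> cbounded D2 g -> cbounded D2 g' ->
  inner m12 (D1 `*` D2) (tensor f g) (tensor f' g') =
  inner m1 D1 f f' * inner m2 D2 g g'.
Proof.
move=> bf /cbounded_conj bf' bg /cbounded_conj bg'.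
rewrite /inner -cint_tensor; try exact: cboundedM.
congr cint; apply/funext => z; rewrite /tensor mulrACA.
by congr (_ * _); exact: rmorphM.
Qed.

(** The indicator of a rectangle is a product, whose factors can be approximated
    one after the other, and rectangles generate the product sigma-algebra.  The
    frequencies are indexed by a single type KK with projections i1 and i2, so
    that frequencies in dimension n.+1 can be used as they are. *)
Lemma tensor_complete (K1 K2 KK : choiceType) (L1 : set K1) (L2 : set K2)
    (E1 : K1 -> X -> R[i]) (E2 : K2 -> Y -> R[i]) (i1 : KK -> K1) (i2 : KK -> K2) :
  (forall k, cmeasurable D1 (E1 k)) -> (forall k, cmeasurable D2 (E2 k)) ->
  (forall k x, normc (E1 k x) ^+ 2 = 1) ->
  (forall k1 k2, exists l, i1 l = k1 /\ i2 l = k2) ->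
  (forall A, measurable A -> approximable m1 D1 L1 E1 (cindic R A)) ->
  (forall B, measurable B -> approximable m2 D2 L2 E2 (cindic R B)) ->
  forall A, measurable A -> approximable m12 (D1 `*` D2)
    [set l | L1 (i1 l) /\ L2 (i2 l)] (fun l => tensor (E1 (i1 l)) (E2 (i2 l)))
    (cindic R A).
Proof.
move=> mE1 mE2 uE1 i12 ap1 ap2.
have mE l : cmeasurable (D1 `*` D2) (tensor (E1 (i1 l)) (E2 (i2 l))).
  exact: cmeasurable_tensor.
have mD := measurable_domainX.
pose LL := [set l | L1 (i1 l) /\ L2 (i2 l)].
pose EE l := tensor (E1 (i1 l)) (E2 (i2 l)).
(* second factor first, for a single exponential on the first one *)
have apE k B : L1 k -> measurable B ->
    approximable m12 (D1 `*` D2) LL EE (tensor (E1 k) (cindic R B)).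
  move=> Lk mB e e0.
  have N0 : (0 <= fine (m1 D1))%R by exact: fine_ge0.
  have [h Lh Bh] := ap2 _ mB _ (divr_gt0 e0 (ltr_pwDr ltr01 N0)).
  have mh := cmeasurable_span (fun l _ => mE2 l) Lh.
  exists (tensor (E1 k) h).
    move: h Lh {Bh mh}; apply: span_ind.
    - rewrite (_ : tensor _ _ = fun=> 0); first exact: span0.
      by apply/funext => z; rewrite /tensor mulr0.
    - move=> g h sg sh; rewrite (_ : tensor _ _ =
        fun z => tensor (E1 k) g z + tensor (E1 k) h z); first exact: spanD.
      by apply/funext => z; rewrite /tensor mulrDr.
    - move=> a k2 Lk2; have [l [l1 l2]] := i12 k k2.
      rewrite (_ : tensor _ _ = fun z => a * EE l z).
        by apply/spanZ/span_mem; rewrite /LL/= l1 l2.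
      by apply/funext => z; rewrite /EE /tensor l1 l2 mulrCA.
  rewrite (_ : (fun z => _) = tensor (E1 k) (fun y => cindic R B y - h y)).
    rewrite sqnorm_tensor//; last first.
      by apply: cmeasurableB => //; exact: cmeasurable_indic.
    have -> : sqnorm m1 D1 (E1 k) = (fine (m1 D1))%:E.
      rewrite /sqnorm; under eq_integral do rewrite uE1.
      by rewrite integral_cst// mul1e fineK// ge0_fin_numE.
    apply: (@le_lt_trans _ _ ((fine (m1 D1))%:E * (e / (fine (m1 D1) + 1))%:E)%E).
      by apply: lee_wpmul2l; [rewrite lee_fin|exact: ltW].
    rewrite -EFinM lte_fin mulrCA -[ltRHS]mulr1 ltr_pM2l// ltr_pdivrMr ?ltr_pwDr//.
    by rewrite mul1r ltrDl.
  by apply/funext => z; rewrite /tensor mulrBr.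
have rect A B : measurable A -> measurable B ->
    approximable m12 (D1 `*` D2) LL EE (tensor (cindic R A) (cindic R B)).
  move=> mA mB; apply: (approximable_closed mD (fun l _ => mE l)).
    by apply: cmeasurable_tensor; exact: cmeasurable_indic.
  move=> e e0; have N0 : (0 <= fine (m2 D2))%R by exact: fine_ge0.
  have [h Lh Ah] := ap1 _ mA _ (divr_gt0 e0 (ltr_pwDr ltr01 N0)).
  have mh := cmeasurable_span (fun l _ => mE1 l) Lh.
  exists (tensor h (cindic R B)); split.
  - by apply: cmeasurable_tensor => //; exact: cmeasurable_indic.
  - suff [] : cmeasurable D1 h /\
        approximable m12 (D1 `*` D2) LL EE (tensor h (cindic R B)) by [].
    move: h Lh {Ah mh}; apply: span_ind.
    + split; first exact: cmeasurable_cst.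
      rewrite (_ : tensor _ _ = fun=> 0); first exact/span_approximable/span0.
      by apply/funext => z; rewrite /tensor mul0r.
    + move=> g h [mg ag] [mh ah]; split; first exact: cmeasurableD.
      rewrite (_ : tensor _ _ = fun z => tensor g (cindic R B) z + tensor h (cindic R B) z).
        by apply: (approximableD mD (fun l _ => mE l)) => //; apply: cmeasurable_tensor => //;
          exact: cmeasurable_indic.
      by apply/funext => z; rewrite /tensor mulrDl.
    + move=> a k Lk; split; first exact: cmeasurableZ.
      rewrite (_ : tensor _ _ = fun z => a * tensor (E1 k) (cindic R B) z).
        apply: (approximableZ mD (fun l _ => mE l)); last exact: apE.
        by apply: cmeasurable_tensor => //; exact: cmeasurable_indic.
      by apply/funext => z; rewrite /tensor mulrA.
  - rewrite (_ : (fun z => _) = tensor (fun x => cindic R A x - h x) (cindic R B)).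
      rewrite sqnorm_tensor//; last 2 first.
      + by apply: cmeasurableB => //; exact: cmeasurable_indic.
      + exact: cmeasurable_indic.
      rewrite sqnorm_indic//.
      apply: (@le_lt_trans _ _ ((e / (fine (m2 D2) + 1))%:E * (fine (m2 D2))%:E)%E).
        rewrite fineK ?ge0_fin_numE//; apply: lee_pmul => //.
        * exact: sqnorm_ge0.
        * exact: ltW.
        * by apply: le_measure; rewrite ?inE//; exact: measurableI.
      rewrite -EFinM lte_fin mulrAC -mulrA -[ltRHS]mulr1 ltr_pM2l//.
      by rewrite ltr_pdivrMr ?ltr_pwDr// mul1r ltrDl.
    by apply/funext => z; rewrite /tensor mulrBl.
have rectE A B : cindic R (A `*` B) = tensor (cindic R A) (cindic R B).
  apply/funext => z; rewrite /tensor /cindic -rmorphM !indicE in_setX.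
  by case: (_ \in A); case: (_ \in B); rewrite /= ?mulr1 ?mulr0.
apply: (@approximable_indic _ _ _ m12 _ mD _ _ _ (fun l _ => mE l)
  [set A `*` B | A in measurable & B in measurable]).
- exact: finite_domainX.
- exact: measurable_prod_measurableType.
- move=> _ _ [A mA [B mB <-]] [A' mA' [B' mB' <-]].
  exists (A `&` A'); first exact: measurableI.
  by exists (B `&` B'); [exact: measurableI|rewrite setXI].
- by rewrite -setXTT rectE; exact: rect.
- by move=> _ [A mA [B mB <-]]; rewrite rectE; exact: rect.
Qed.

End product_domain.

(** * Slices of a spectrum of a product *)

Section slice.
Context d (Y : measurableType d) (R : realType).
Variable nu : {sigma_finite_measure set Y -> \bar R}.
Variables (a b : R) (S : set Y) (M : R).
Hypotheses (ab : a < b) (mS : measurable S) (SM : nu S = M%:E) (M0 : 0 < M).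
Context (K KK : choiceType) (e : K -> Y -> R[i]) (tt : KK -> R) (ss : KK -> K).
Hypothesis me : forall k, cmeasurable S (e k).
Hypothesis e1 : forall k y, normc (e k y) ^+ 2 = 1.
Hypothesis ttss : forall t k, exists l, tt l = t /\ ss l = k.
Notation leb := (@lebesgue_measure R).
Let ell := b - a.
Let p := ell^-1.
Let J := `[a, b]%classic : set (measurableTypeR R).
Let EE (l : KK) := tensor (fun x : measurableTypeR R => ee (tt l * x)) (e (ss l)).
Variable Lam : set KK.
Hypothesis countable_Lam : countable Lam.
Hypothesis orth_Lam : forall l m, Lam l -> Lam m -> l <> m ->
  inner (leb \x nu)%E (J `*` S) (EE l) (EE m) = 0.
Hypothesis complete_Lam : forall A, measurable A ->
  approximable (leb \x nu)%E (J `*` S) Lam EE (cindic R A).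

Let ell0 : 0 < ell. Proof. by rewrite subr_gt0. Qed.
Let p0 : 0 < p. Proof. by rewrite invr_gt0. Qed.
Let mJ : measurable J. Proof. exact: measurable_itv. Qed.
Let Joo : (leb J < +oo)%E.
Proof. by rewrite [X in (X < _)%E](lebesgue_segment ab) ltry. Qed.
Let Soo : (nu S < +oo)%E. Proof. by rewrite SM ltry. Qed.

Let cbe k : cbounded S (e k). Proof. exact: cbounded_unimodular. Qed.

Let cmee t : cmeasurable J (fun x => ee (t * x)).
Proof. by apply: cmeasurable_ee; exact: measurable_funM. Qed.

Let cbee t : cbounded J (fun x => ee (t * x)).
Proof. by apply: cbounded_unimodular => // x; exact: normc2_ee. Qed.

Let mEE l : cmeasurable (J `*` S) (EE l).
Proof. exact: cmeasurable_tensor. Qed.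

Let EE1 l z : normc (EE l z) ^+ 2 = 1.
Proof. by rewrite normc2M normc2_ee e1 mulr1. Qed.

Let inner_EE l m : inner (leb \x nu)%E (J `*` S) (EE l) (EE m) =
  fwin a b (tt l - tt m) * inner nu S (e (ss l)) (e (ss m)).
Proof. by rewrite inner_tensor// inner_ee. Qed.

Definition fourier2 (k : K) (l : KK) : R := normc (inner nu S (e k) (e (ss l))) ^+ 2.

Let fourier2_ge0 k l : 0 <= fourier2 k l. Proof. exact: sqr_ge0. Qed.

Definition slice x : set KK := [set l | Lam l /\ x <= tt l < x + p].

(** The first factor of the inner product does not vanish at frequencies that
    differ by less than p. *)
Lemma slice_orthogonal x l m : slice x l -> slice x m -> l <> m ->
  inner nu S (e (ss l)) (e (ss m)) = 0.
Proof.
move=> [Ll /andP[xl lx]] [Lm /andP[xm mx]] lm.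
have := orth_Lam Ll Lm lm; rewrite inner_EE => /eqP; rewrite mulf_eq0.
rewrite (negbTE (fwin_neq0 ab _)) => [/eqP//|].
rewrite -ltr_pdivlMr// div1r ltr_norml (_ : (b - a)^-1 = p)//.
by apply/andP; split; lra.
Qed.

Lemma slice_bessel x k : (\esum_(l in slice x) (fourier2 k l)%:E <= (M ^+ 2)%:E)%E.
Proof.
apply: (@bessel _ _ _ nu S mS Soo _ (slice x) (fun l => e (ss l)) M) => //.
exact: slice_orthogonal.
Qed.

(** Parseval equality on the product, for the exponential of frequency (u, k). *)
Lemma slice_parseval u k :
  (\esum_(l in Lam) (fwin2 a b (u - tt l) * fourier2 k l)%:E =
   ((ell * M) ^+ 2)%:E)%E.
Proof.
have mJS : measurable (J `*` S) by exact: measurableX.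
have [l0 [<- <-]] := ttss u k.
have JSN : (leb \x nu)%E (J `*` S) = (ell * M)%:E.
  by rewrite measure_domainX// [X in (X * _)%E](lebesgue_segment ab) SM.
rewrite -(@parseval _ _ _ (leb \x nu)%E (J `*` S) mJS _ _ Lam EE _ JSN _ mEE EE1
  orth_Lam (EE l0)) //.
- by apply: eq_esum => l _; rewrite inner_EE normc2M.
- exact: finite_domainX.
- exact: mulr_gt0.
apply: (approximable_of_indic mJS (fun l _ => mEE l)) => //.
by rewrite (sqnorm_unimodular mJS JSN (EE1 l0)) ltry.
Qed.

(** The sum of fourier2 k over the slice at x, written as a sum over Lam of functions
    of x in order to integrate it. *)
Let h (k : K) (x : measurableTypeR R) : \bar R :=
  \esum_(l in Lam) (\1_(`]tt l - p, tt l]%classic : set R) x * fourier2 k l)%:E.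

Let h_slice k x : h k x = \esum_(l in slice x) (fourier2 k l)%:E.
Proof.
rewrite /h (esum_mkcond Lam) [RHS]esum_mkcond; apply: eq_esum => l _.
have -> : (l \in slice x) = (l \in Lam) && (x \in (`]tt l - p, tt l]%classic : set R)).
  apply/idP/andP => [/set_mem[Ll /andP[h1 h2]]|[/set_mem Ll /set_mem]].
    split; first exact/mem_set.
    by apply/mem_set; rewrite /= in_itv/= h1 andbT ltrBlDr.
  by rewrite /= in_itv/= => /andP[h1 h2]; apply/mem_set; split => //; rewrite h2 -ltrBlDr.
case: (l \in Lam) => //=; rewrite indicE.
by case: (_ \in _); rewrite ?mul1r ?mul0r.
Qed.

Let mh k : measurable_fun setT (h k).
Proof.
apply: measurable_esum => // [l|l x]; last by rewrite lee_fin mulr_ge0.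
apply/measurable_EFinP; exact: measurable_funM.
Qed.

Let h_ge0 k x : (0 <= h k x)%E.
Proof. by apply: esum_ge0 => l _; rewrite lee_fin mulr_ge0. Qed.

Let h_le k x : (h k x <= (M ^+ 2)%:E)%E.
Proof. by rewrite h_slice; exact: slice_bessel. Qed.

(** A point of Lam belongs to the slices at x for x in an interval of length p;
    translating this interval to ]- p, 0] turns the integral into that of Parseval
    equality over a period, the window being even. *)
Let integral_h k : (\int[leb]_x (h k x * (fwin2 a b x)%:E) = (ell * M ^+ 2)%:E)%E.
Proof.
pose I0 := `]- p, 0]%classic : set (measurableTypeR R).
have mI0 : measurable I0 by exact: measurable_itv.
have mw := measurable_fwin2 ab.
pose G l (x : measurableTypeR R) : \bar R :=
  (\1_I0 (x - tt l) * fourier2 k l * fwin2 a b x)%:E.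
have G0 l x : (0 <= G l x)%E.
  by rewrite lee_fin mulr_ge0 ?sqr_ge0// mulr_ge0.
have mG l : measurable_fun setT (G l).
  apply/measurable_EFinP; apply: measurable_funM => //.
  apply: measurable_funM => //; apply: measurableT_comp; first exact: measurable_indic.
  exact: measurable_funB.
transitivity (\int[leb]_x (\esum_(l in Lam) G l x))%E.
  apply: eq_integral => x _; rewrite /h.
  rewrite (_ : (fun l => _) = (fun l => (\1_I0 (x - tt l) * fourier2 k l)%:E)); last first.
    apply/funext => l; rewrite !indicE; congr ((nat_of_bool _)%:R * _)%:E.
    by apply/idP/idP => /set_mem; rewrite /I0/= !in_itv/= => /andP[? ?];
      apply/mem_set; rewrite /I0/= in_itv/=; apply/andP; split; lra.
  have wx0 : 0 <= fwin2 a b x by exact: sqr_ge0.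
  rewrite (esumZr countable_Lam _ wx0); first by [].
  by move=> l; rewrite lee_fin mulr_ge0.
rewrite integral_esum//.
transitivity (\esum_(l in Lam) \int[leb]_x (G l (x + tt l)%R))%E.
  by apply: eq_esum => l _; rewrite ge0_integral_shift.
rewrite -integral_esum//; last first.
  by move=> l; apply: measurableT_comp; [exact: mG|exact: measurable_funD].
transitivity (\int[leb]_x (((ell * M) ^+ 2)%:E * (\1_I0 x)%:E))%E.
  apply: eq_integral => x _; rewrite indicE; have [xI|xI] := boolP (x \in I0).
    rewrite mule1 -(slice_parseval (- x) k); apply: eq_esum => l _.
    rewrite /G addrK indicE xI mul1r mulrC (_ : x + tt l = - (- x - tt l)).
      by rewrite fwin2N.
    by rewrite opprD !opprK.
  rewrite mule0 esum1// => l _.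
  by rewrite /G addrK indicE (negbTE xI) !mul0r.
rewrite ge0_integralZl//; last 2 first.
- by apply/measurable_EFinP; exact: measurable_indic.
- by rewrite lee_fin sqr_ge0.
rewrite integral_indic// setIT [X in (_ * X)%E](_ : _ = p%:E); last first.
  by rewrite [LHS]lebesgue_measure_itv/= lte_fin oppr_lt0 p0 -EFinB sub0r opprK.
by rewrite -EFinM; congr EFin; rewrite /p; field; rewrite gt_eqF.
Qed.

(** Bessel inequality on the slices and the bound on the total mass of the
    window leave no room: the slices satisfy Parseval equality almost
    everywhere near the origin. *)
Let h_ae k : {ae leb, forall x, - p < x < p -> h k x = (M ^+ 2)%:E}.
Proof.
have mw := measurable_fwin2 ab.
have mwE : measurable_fun setT (fun x : measurableTypeR R => (fwin2 a b x)%:E).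
  exact/measurable_EFinP.
have w0 x : (0 <= (fwin2 a b x)%:E)%E by rewrite lee_fin sqr_ge0.
pose gap x := (((M ^+ 2)%:E - h k x) * (fwin2 a b x)%:E)%E.
have hfin x : h k x \is a fin_num.
  by rewrite ge0_fin_numE// (le_lt_trans (h_le k x))// ltry.
have gap0 x : (0 <= gap x)%E by apply: mule_ge0 => //; rewrite sube_ge0 ?hfin// h_le.
have mgap : measurable_fun setT gap.
  by apply: emeasurable_funM => //; apply: emeasurable_funB.
have gapE : (\int[leb]_x gap x + (ell * M ^+ 2)%:E <= (ell * M ^+ 2)%:E)%E.
  rewrite -[X in (_ + X)%E](integral_h k) -ge0_integralD//; last 2 first.
  - by move=> x _; rewrite mule_ge0.
  - exact: emeasurable_funM.
  apply: (@le_trans _ _ (\int[leb]_x ((M ^+ 2)%:E * (fwin2 a b x)%:E))%E).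
    rewrite le_eqVlt; apply/orP; left; apply/eqP; apply: eq_integral => x _.
    by rewrite /gap muleBl// subeK// fin_numM.
  rewrite ge0_integralZl//; last by rewrite lee_fin sqr_ge0.
  rewrite [leRHS]EFinM muleC; apply: lee_pmul => //.
  + by apply: integral_ge0.
  + by rewrite lee_fin sqr_ge0.
  + exact: integral_fwin2_le.
have gapint0 : (\int[leb]_x `|gap x| = 0)%E.
  apply/eqP; rewrite eq_le; apply/andP; split; last exact: integral_ge0.
  under eq_integral do rewrite gee0_abs//.
  by move: gapE; rewrite -[leRHS]add0e leeD2rE.
have := (ae_eq_integral_abs leb (@measurableT _ _) mgap).1 gapint0.
apply: filterS => x /(_ I) /= /eqP; rewrite mule_eq0 => /orP[|].
  by have /fineK <- := hfin x; rewrite -EFinB eqe subr_eq0 => /eqP ->.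
rewrite eqe sqrf_eq0 => /eqP/eq0_normc w00 xp.
have := @fwin_neq0 _ _ _ ab x; rewrite w00 eqxx => /(_ _)/negP[]//.
by rewrite -ltr_pdivlMr// div1r ltr_norml.
Qed.

(** One abscissa suits all the countably many frequencies at once. *)
Lemma slice_approximable : exists x, forall l, Lam l ->
  approximable nu S (slice x) (fun m => e (ss m)) (e (ss l)).
Proof.
have /countable_injP[f finj] := countable_Lam.
have : {ae leb, forall x n, forall l, Lam l -> f l = n -> - p < x < p ->
    h (ss l) x = (M ^+ 2)%:E}.
  apply: ae_foralln => n.
  have [[l [Ll fl]]|nl] := pselect (exists l, Lam l /\ f l = n).
    have := h_ae (ss l); apply: (@filterS _ _ (ae_filter_ringOfSetsType leb)) => x hx m Lm fm.
    by have -> : m = l by apply: finj; rewrite ?inE ?fl.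
  by apply: aeW => x l Ll fl; exfalso; apply: nl; exists l.
move=> [N [mN N0 subN]].
have [x [xp Nx]] : exists x, - p < x < p /\ ~ N x.
  apply: contrapT => none.
  pose I0 : set (measurableTypeR R) := `](- p), p[%classic.
  have pN : I0 `<=` N.
    move=> x; rewrite /I0/= in_itv/= => xp; apply: contrapT => Nx.
    by apply: none; exists x.
  have : (leb I0 <= leb N)%E.
    by apply: le_measure; rewrite ?inE//; exact: measurable_itv.
  rewrite N0 [X in (X <= _)%E]lebesgue_measure_itv/= lte_fin gtrN// -EFinB lee_fin.
  by rewrite opprK leNgt addr_gt0.
exists x => l Ll.
have hx : h (ss l) x = (M ^+ 2)%:E.
  by apply: contrapT => hx; apply: Nx; apply: subN => /= /(_ (f l) l Ll erefl xp).
apply: (@approximable_of_parseval _ _ _ nu S mS Soo _ _ _ _ SM M0) => //.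
  exact: slice_orthogonal.
by rewrite -hx h_slice.
Qed.

(** The frequencies of a spectrum of the cylinder span L2 of the base: restrict
    an approximation of a function of the base to a suitable horizontal
    section. *)
Lemma base_approximable B : measurable B ->
  approximable nu S Lam (fun l => e (ss l)) (cindic R B).
Proof.
move=> mB eps eps0.
have mJS : measurable (J `*` S) by exact: measurableX.
have [g Lg gB] := complete_Lam (measurableX (@measurableT _ _) mB) (mulr_gt0 eps0 ell0).
have mg := cmeasurable_span (fun l _ => mEE l) Lg.
have sec x : span Lam (fun l => e (ss l)) (fun y => g (x, y)).
  move: g Lg {gB mg}; apply: (span_ind (P := [set g | span _ _ (fun y => g (x, y))])).
  - exact: span0.
  - by move=> g g'; exact: spanD.
  - move=> c l Ll /=; rewrite (_ : (fun y => _) =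
      fun y => (c * ee (tt l * x)) * e (ss l) y); first exact/spanZ/span_mem.
    by apply/funext => y; rewrite /EE /tensor mulrA.
suff [x xlt] : exists x, (sqnorm nu S (fun y => cindic R B y - g (x, y))%R < eps%:E)%E.
  by exists (fun y => g (x, y)).
apply: contrapT => none.
have : ((eps * ell)%:E <= sqnorm (leb \x nu)%E (J `*` S)
    (fun z => cindic R (setT `*` B) z - g z)%R)%E.
  rewrite /sqnorm ge0_integralX//; last 2 first.
  - apply: emeasurable_normc2; apply: cmeasurableB => //.
    by apply: cmeasurable_indic; exact: measurableX.
  - by move=> z _; rewrite lee_fin normc2_ge0.
  apply: (@le_trans _ _ (\int[leb]_(x in J) eps%:E)%E).
    by rewrite integral_cst// [X in (_ * X)%E](lebesgue_segment ab).
  have mgB : cmeasurable (J `*` S) (fun z => cindic R (setT `*` B) z - g z).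
    by apply: cmeasurableB => //; apply: cmeasurable_indic; exact: measurableX.
  apply: ge0_le_integral => //.
  - by move=> x _; rewrite lee_fin ltW.
  - apply: (@measurable_sectionX _ _ _ _ _ nu J S mJ mS
      (fun z => (normc (cindic R (setT `*` B) z - g z) ^+ 2)%:E)); last by move=> z _; rewrite lee_fin normc2_ge0.
    exact: emeasurable_normc2.
  - move=> x _; rewrite leNgt; apply/negP => xlt; apply: none; exists x.
    apply: le_lt_trans xlt; rewrite le_eqVlt; apply/orP; left; apply/eqP.
    apply: eq_integral => y _; congr (normc (_ - _) ^+ 2)%:E.
    by rewrite /cindic !indicE in_setX in_setT.
by rewrite leNgt gB.
Qed.

Lemma slice_spectrum : exists x,
  (forall s s', (ss @` slice x) s -> (ss @` slice x) s' -> s <> s' ->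
     inner nu S (e s) (e s') = 0) /\
  (forall B, measurable B -> approximable nu S (ss @` slice x) e (cindic R B)).
Proof.
have [x xap] := slice_approximable; exists x; split.
  move=> _ _ [l sl <-] [m sm <-] lm; apply: (slice_orthogonal sl sm).
  by move=> E; apply: lm; rewrite E.
have slice_sub f : cmeasurable S f ->
    approximable nu S (slice x) (fun m => e (ss m)) f ->
    approximable nu S (ss @` slice x) e f.
  apply: approximable_trans => // l sl; apply: span_approximable.
  by apply: span_mem; exists l.
move=> B mB; apply: approximable_trans (base_approximable mB) => //.
- by move=> l Ll; apply: slice_sub => //; exact: xap.
- exact: cmeasurable_indic.
Qed.

End slice.

(** * Lebesgue measurable sets and Borel models *)

Section borel_hull.
Context d (T : measurableType d) (R : realType).
Variable mu : {measure set T -> \bar R}.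
Notation cara := (caratheodory_type (mu_ext mu)).
Notation cmu := (@completed_measure_extension _ _ _ mu).

Lemma measurable_cara (B : set T) : measurable B -> measurable (B : set cara).
Proof. by move=> mB; exact: caratheodory_measurable_mu_ext. Qed.

Lemma completed_borel (B : set T) : measurable B -> cmu B = mu B.
Proof. exact: measurable_mu_extE. Qed.

(** Intersecting countable covers of nearly optimal mass. *)
Lemma outer_hull (A : set T) : (cmu A < +oo)%E ->
  exists B : set T, [/\ measurable B, A `<=` B & mu B = cmu A].
Proof.
move=> Aoo.
have Afin : cmu A \is a fin_num by rewrite ge0_fin_numE.
have cover n : exists F : (set T)^nat, measurable_cover A F /\
    (\sum_(0 <= k <oo) mu (F k) < cmu A + (n.+1%:R^-1)%:E)%E.
  have n0 : 0 < n.+1%:R^-1 :> R by rewrite invr_gt0.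
  have /(lb_ereal_inf_adherent n0)[_ /= [F AF <-] ?] := Afin.
  by exists F.
pose F n := projT1 (cid (cover n)).
have AF n : measurable_cover A (F n) by rewrite /F; case: cid => ? [].
have FA n : (\sum_(0 <= k <oo) mu (F n k) < cmu A + (n.+1%:R^-1)%:E)%E.
  by rewrite /F; case: cid => ? [].
pose B := \bigcap_n \bigcup_k F n k.
have mF n : measurable (\bigcup_k F n k).
  by apply: bigcupT_measurable => k; have [/(_ k)] := AF n.
have mB : measurable B by exact: bigcapT_measurable.
have AB : A `<=` B by apply: sub_bigcap => n _; have [] := AF n.
exists B; split => //; apply/eqP; rewrite eq_le; apply/andP; split; last first.
  by rewrite -completed_borel//; exact: le_outer_measure.
apply/lee_addgt0Pr => /= _/posnumP[eps]; near \oo => n.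
apply: (@le_trans _ _ (mu (\bigcup_k F n k))).
  by apply: le_measure; rewrite ?inE//; exact: bigcap_inf.
apply: (@le_trans _ _ (\sum_(0 <= k <oo) mu (F n k))%E).
  by apply: measure_sigma_subadditive => // k; have [/(_ k)] := AF n.
apply: (le_trans (ltW (FA n))); rewrite leeD// lee_fin ltW//.
by near: n; exact: near_infty_natSinv_lt.
Unshelve. all: by end_near. Qed.

(** What a Borel hull adds to A is null, hence has itself a null Borel hull. *)
Lemma borel_hull (A : set cara) : measurable A -> (cmu A < +oo)%E ->
  exists B N : set T, [/\ measurable B, measurable N, mu N = 0 &
    forall x, ~ N x -> (A x <-> B x)].
Proof.
move=> mA Aoo; have [B [mB AB BA]] := outer_hull Aoo.
have mBc := measurable_cara mB.
have BA0 : cmu ((B : set cara) `\` A) = 0.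
  have Boo : (cmu (B : set cara) < +oo)%E by rewrite completed_borel// BA.
  rewrite measureD//= (setIidr AB) [X in (X - _)%E]completed_borel// BA subee//.
  by rewrite ge0_fin_numE.
have [|N [mN BAN N0]] := @outer_hull (B `\` A); first by rewrite BA0 ltry.
exists B, N; split => //; first by rewrite N0.
move=> x Nx; split=> [/AB//|Bx]; apply: contrapT => Ax.
by apply: Nx; apply: BAN.
Qed.

End borel_hull.

Section transfer.
Context d d' (T : measurableType d) (T' : measurableType d') (R : realType).
Variables (mu : {measure set T -> \bar R}) (mu' : {measure set T' -> \bar R}).
Variable phi : T -> T'.
Hypothesis mphi : measurable_fun setT phi.
Hypothesis muE : forall B, measurable B -> mu' B = mu (phi @^-1` B).

Let mpre B : measurable B -> measurable (phi @^-1` B).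
Proof. by move=> mB; rewrite -[_ @^-1` _]setTI; exact: mphi. Qed.

(** The exceptional set is an inverse image too, so that its mass can be read off
    from mu'. *)
Definition same_ae (A : set T) (B : set T') := exists2 N : set T',
  measurable N /\ mu' N = 0 & forall x, ~ N (phi x) -> (A x <-> B (phi x)).

Variables (D : set T) (D' : set T').
Hypotheses (mD : measurable D) (mD' : measurable D') (DD' : same_ae D D').

Lemma ge0_integral_transfer (f : T' -> \bar R) :
  measurable_fun setT f -> (forall y, 0 <= f y)%E ->
  (\int[mu]_(x in D) f (phi x) = \int[mu']_(y in D') f y)%E.
Proof.
move=> mf f0.
transitivity (\int[pushforward mu phi]_(y in D') f y)%E; last first.
  by apply: eq_measure_integral => B mB _; rewrite /pushforward muE.
rewrite ge0_integral_pushforward//; last exact: measurable_funTS.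
have mfphi : measurable_fun setT (f \o phi) by exact: measurableT_comp.
rewrite [LHS]integral_mkcond [RHS]integral_mkcond; apply: ge0_ae_eq_integral => //.
- by apply/(measurable_restrictT _ _).1 => //; exact: measurable_funTS.
- by apply/(measurable_restrictT _ _).1; [exact: mpre|exact: measurable_funTS].
- by move=> x _; rewrite patchE; case: ifP.
- by move=> x _; rewrite patchE; case: ifP => //= _; exact: f0.
have [N [mN N0] DN] := DD'.
exists (phi @^-1` N); split; [exact: mpre|by rewrite -muE|].
move=> x; apply: contra_notP => Nx _; rewrite !patchE.
suff -> : (x \in D) = (x \in phi @^-1` D') by [].
by apply/idP/idP => /set_mem ?; apply/mem_set; apply/(DN x Nx).
Qed.

Lemma measure_transfer : mu D = mu' D'.
Proof.
have := ge0_integral_transfer (f := cst 1%E) (@measurable_cst _ _ _ _ _ _) (fun=> lee01).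
by rewrite !integral_cst// !mul1e.
Qed.

Lemma sqnorm_transfer (f : T' -> R[i]) : cmeasurable setT f ->
  sqnorm mu D (f \o phi) = sqnorm mu' D' f.
Proof.
move=> mf; rewrite /sqnorm -ge0_integral_transfer//.
  exact: emeasurable_normc2.
by move=> y; rewrite lee_fin normc2_ge0.
Qed.

Lemma Rintegral_transfer (g : T' -> R) : measurable_fun setT g ->
  (\int[mu]_(x in D) g (phi x))%R = (\int[mu']_(y in D') g y)%R.
Proof.
move=> mg; have mg' : measurable_fun setT (EFin \o g) by exact/measurable_EFinP.
rewrite /Rintegral (integralE mu) (integralE mu'); congr (fine (_ - _)).
- rewrite -(ge0_integral_transfer (f := (EFin \o g)^\+)%E)//; last first.
    exact: measurable_funepos.
  by apply: eq_integral => x _; rewrite !funeposE.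
- rewrite -(ge0_integral_transfer (f := (EFin \o g)^\-)%E)//; last first.
    exact: measurable_funeneg.
  by apply: eq_integral => x _; rewrite !funenegE.
Qed.

Lemma inner_transfer (f g : T' -> R[i]) : cmeasurable setT f -> cmeasurable setT g ->
  inner mu D (f \o phi) (g \o phi) = inner mu' D' f g.
Proof.
move=> mf [mg1 mg2]; rewrite /inner /cint.
have [mRe mIm] : cmeasurable setT (fun y => f y * conjc (g y)).
  apply: cmeasurableM => //; split.
    by rewrite (_ : (fun y => _) = fun y => complex.Re (g y))//;
      apply/funext => y; case: (g y).
  rewrite (_ : (fun y => _) = fun y => - complex.Im (g y)).
    exact: measurable_funN.
  by apply/funext => y; case: (g y).
by congr (_ +i* _); rewrite -Rintegral_transfer.
Qed.

Context (K : choiceType) (L : set K) (E : K -> T' -> R[i]).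
Hypothesis mE : forall k, cmeasurable setT (E k).
Let Ephi k := E k \o phi.

Let span_transfer h : span L E h -> span L Ephi (h \o phi).
Proof. by move=> [s [c [sL ->]]]; exists s, c. Qed.

Let span_lift h : span L Ephi h -> exists2 h', span L E h' & h = h' \o phi.
Proof.
move=> [s [c [sL ->]]]; exists (fun y => \sum_(l <- s) c l * E l y) => //.
by exists s, c.
Qed.

Let cmeasurable_phi (A : set T) (f : T' -> R[i]) : cmeasurable setT f ->
  cmeasurable A (f \o phi).
Proof.
by move=> [f1 f2]; split; apply: measurable_funTS;
  [exact: (measurableT_comp f1)|exact: (measurableT_comp f2)].
Qed.

Lemma approximable_transfer (f : T' -> R[i]) : cmeasurable setT f ->
  approximable mu' D' L E f <-> approximable mu D L Ephi (f \o phi).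
Proof.
have mspan h : span L E h -> cmeasurable setT h.
  by apply: cmeasurable_span => k _; exact: mE.
move=> mf; split=> Lf e e0; have [h Lh fh] := Lf e e0.
  exists (h \o phi); first exact: span_transfer.
  rewrite (_ : (fun x => _) = (fun y => f y - h y) \o phi)// sqnorm_transfer//.
  by apply: cmeasurableB => //; exact: mspan.
have [h' Lh' hh'] := span_lift Lh; exists h' => //.
rewrite -sqnorm_transfer//.
  by move: fh; rewrite hh'.
by apply: cmeasurableB => //; exact: mspan.
Qed.

(** Indicators suffice, and up to null sets the measurable subsets of D are inverse
    images. *)
Lemma approximable_indic_transfer :
  (forall A, measurable A -> (mu A < +oo)%E -> exists2 B, measurable B & same_ae A B) ->
  (mu D < +oo)%E ->
  (forall B, measurable B -> approximable mu' D' L E (cindic R B)) ->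
  forall f, cmeasurable D f -> (sqnorm mu D f < +oo)%E -> approximable mu D L Ephi f.
Proof.
move=> hull Doo ap.
have mEphi k : L k -> cmeasurable D (Ephi k) by move=> _; exact: cmeasurable_phi.
move=> f mf foo; apply: (approximable_of_indic mD mEphi _ mf foo) => A mA.
have [|B mB [N [mN N0] AB]] := hull (A `&` D) (measurableI _ _ mA mD).
  by apply: le_lt_trans Doo; apply: le_measure; rewrite ?inE//; exact: measurableI.
have : approximable mu D L Ephi (cindic R B \o phi).
  by apply/approximable_transfer; [exact: cmeasurable_indic|exact: ap].
apply: (approximable_ae mD mEphi).
- by apply: cmeasurable_phi; exact: cmeasurable_indic.
- exact: cmeasurable_indic.
exists (phi @^-1` N); split; [exact: mpre|by rewrite -muE|].
move=> x; apply: contra_notP => Nx Dx; rewrite /cindic /= !indicE.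
congr ((nat_of_bool _)%:R%:C); apply/idP/idP => /set_mem ?; apply/mem_set.
  by have [] := (AB x Nx).2.
by apply/(AB x Nx).
Qed.

End transfer.

Section borel_model.
Context (R : realType).
Implicit Types n : nat.

Notation nu n := (borel_lebesgue R n).
Notation lebn n := (@completed_measure_extension _ _ _ (nu n)).
Notation leb := (@lebesgue_measure R).

Lemma expo_ee n (l x : Rn R n) : expo l x = ee (dotp l x).
Proof. by []. Qed.

Lemma dotpBl n (l m x : Rn R n) :
  dotp l x - dotp m x = \sum_(i < n) (tnth l i - tnth m i) * tnth x i.
Proof. by rewrite /dotp -sumrB; apply: eq_bigr => i _; rewrite mulrBl. Qed.

Lemma measurable_dotp n (l : n.-tuple R) :
  measurable_fun setT (fun x : n.-tuple R => dotp l x).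
Proof.
apply: measurable_sum => i; apply: measurable_funM => //.
exact: measurable_tnth.
Qed.

Lemma cmeasurable_expo n (l : n.-tuple R) (D : set (n.-tuple R)) :
  cmeasurable D (expo l : n.-tuple R -> R[i]).
Proof. by apply: cmeasurable_ee; apply: measurable_funTS; exact: measurable_dotp. Qed.

Lemma normc2_expo n (l x : n.-tuple R) : normc (expo l x) ^+ 2 = 1.
Proof. exact: normc2_ee. Qed.

Definition split_tuple n (x : n.+1.-tuple R) : measurableTypeR R * n.-tuple R :=
  (thead x, [tuple of behead x]).

Lemma cons_pairK n : cancel (@cons_pair R n) (@split_tuple n).
Proof. by move=> [a b]; congr pair => //; exact: val_inj. Qed.

Lemma split_tupleK n : cancel (@split_tuple n) (@cons_pair R n).
Proof. by move=> x; rewrite /cons_pair /= [RHS]tuple_eta. Qed.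

Lemma measurable_split_tuple n : measurable_fun setT (@split_tuple n).
Proof.
apply: measurable_fun_pair; first exact: measurable_tnth.
exact: measurable_behead.
Qed.

Lemma dotp_split n (l x : n.+1.-tuple R) : dotp l x =
  (split_tuple l).1 * (split_tuple x).1 + dotp (split_tuple l).2 (split_tuple x).2.
Proof.
rewrite /dotp big_ord_recl; congr (_ + _); apply: eq_bigr => i _.
by rewrite -{1}(split_tupleK l) -{1}(split_tupleK x) !tnthS.
Qed.

Lemma expo_split n (l x : n.+1.-tuple R) : expo l x =
  tensor (fun t : measurableTypeR R => ee ((split_tuple l).1 * t))
    (expo (split_tuple l).2 : n.-tuple R -> R[i]) (split_tuple x).
Proof. by rewrite expo_ee dotp_split eeD. Qed.

Lemma borel_lebesgue_split n (B : set (measurableTypeR R * n.-tuple R)) :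
  (leb \x nu n)%E B = nu n.+1 (@split_tuple n @^-1` B).
Proof.
rewrite /= /cons_measure /pushforward -comp_preimage.
rewrite (_ : _ \o _ = id) ?preimage_id//.
by apply/funext => x; exact: cons_pairK.
Qed.

Lemma measurable_Rn n d (T : measurableType d) (f : n.-tuple R -> T) :
  measurable_fun setT f -> measurable_fun setT (f : Rn R n -> T).
Proof.
move=> mf _ B mB; have := mf measurableT B mB.
exact: measurable_cara.
Qed.

Lemma lebesgue_id n (B : set (n.-tuple R)) : measurable B ->
  nu n B = lebn n (idfun @^-1` B).
Proof. by move=> mB; rewrite -completed_borel. Qed.

Lemma lebesgue_split n (B : set (measurableTypeR R * n.-tuple R)) :
  measurable B -> (leb \x nu n)%E B = lebn n.+1 (@split_tuple n @^-1` B).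
Proof.
move=> mB; rewrite borel_lebesgue_split -completed_borel//.
by rewrite -[_ @^-1` _]setTI; exact: measurable_split_tuple.
Qed.

Lemma hull_id n (A : set (Rn R n)) : measurable A -> (lebn n A < +oo)%E ->
  exists2 B, measurable B & same_ae (nu n) (idfun : Rn R n -> n.-tuple R) A B.
Proof.
move=> mA Aoo; have [B [N [mB mN N0 AB]]] := borel_hull mA Aoo.
by exists B => //; exists N.
Qed.

Lemma hull_split n (A : set (Rn R n.+1)) : measurable A -> (lebn n.+1 A < +oo)%E ->
  exists2 B, measurable B & same_ae (leb \x nu n)%E (@split_tuple n : Rn R n.+1 -> _) A B.
Proof.
move=> mA Aoo; have [B [N [mB mN N0 AB]]] := borel_hull mA Aoo.
have mcons C : measurable C -> measurable (@cons_pair R n @^-1` C).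
  by move=> mC; rewrite -[_ @^-1` _]setTI; exact: measurable_cons_pair.
exists (@cons_pair R n @^-1` B); first exact: mcons.
exists (@cons_pair R n @^-1` N); first by split; [exact: mcons|exact: N0].
by move=> x; rewrite /preimage /= split_tupleK; exact: AB.
Qed.

(** A bounded set lies in a cube, whose measure is computed by induction on the
    dimension. *)
Lemma bounded_finite n (A : set (Rn R n)) : bounded_Rn A -> (lebn n A < +oo)%E.
Proof.
move=> [M AM].
have box : exists B : set (n.-tuple R), [/\ measurable B,
    forall x : n.-tuple R, (forall i, `|tnth x i| <= M) -> B x & (nu n B < +oo)%E].
  elim: n {A AM} => [|n [B [mB MB Boo]]].
    exists setT; split => //=; rewrite diracT.
    by rewrite ltry.
  exists (@split_tuple n @^-1` (`[- M, M]%classic `*` B)); split.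
  - rewrite -[_ @^-1` _]setTI; apply: measurable_split_tuple => //.
    by apply: measurableX => //; exact: measurable_itv.
  - move=> x xM; split => /=.
      by rewrite in_itv/= -ler_norml; exact: xM.
    by apply: MB => i; have := xM (lift ord0 i); rewrite -{1}(split_tupleK x) tnthS.
  - rewrite -borel_lebesgue_split product_measure1E//.
    rewrite lte_mul_pinfty// ?ge0_fin_numE//.
    by rewrite [X in (X < _)%E]lebesgue_measure_itv/=; case: ifP => _; rewrite -?EFinB ltry.
have [B [mB MB Boo]] := box.
apply: (@le_lt_trans _ _ (lebn n B)); last by rewrite completed_borel.
by apply: le_outer_measure => x Ax; apply: MB => i; exact: AM.
Qed.

Section spectrum_transfer.
Variables (n : nat) (d : measure_display) (T' : measurableType d).
Variables (mu' : {measure set T' -> \bar R}) (phi : Rn R n -> T').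
Hypothesis mphi : measurable_fun setT phi.
Hypothesis muE : forall B, measurable B -> mu' B = lebn n (phi @^-1` B).
Hypothesis hull : forall A : set (Rn R n), measurable A -> (lebn n A < +oo)%E ->
  exists2 B, measurable B & same_ae mu' phi A B.
Variable E : n.-tuple R -> T' -> R[i].
Hypothesis mE : forall l, cmeasurable setT (E l).
Hypothesis expoE : forall l x, expo l x = E l (phi x).
Variables (D : set (Rn R n)) (D' : set T').
Hypotheses (mD : measurable D) (mD' : measurable D') (DD' : same_ae mu' phi D D').
Hypothesis Doo : (lebn n D < +oo)%E.

Lemma inner_L2_transfer (l m : Rn R n) :
  inner_L2 D (expo l) (expo m) = inner mu' D' (E l) (E m).
Proof.
have ephi k : (expo k : Rn R n -> R[i]) = E k \o phi.
  by apply/funext => x; exact: expoE.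
by rewrite /inner_L2 !ephi -(inner_transfer mphi muE mD mD' DD' (mE l) (mE m)).
Qed.

Lemma complete_system_transfer (L : set (Rn R n)) : complete_system D L <->
  forall B, measurable B -> approximable mu' D' L E (cindic R B).
Proof.
have EphiE : (fun l => E l \o phi) = (fun l => expo l : Rn R n -> R[i]).
  by apply/funext => l; apply/funext => x; rewrite /= expoE.
split=> [cL B mB|ap f [f1 f2 foo] e e0].
  apply/(approximable_transfer mphi muE mD mD' DD' L mE); first exact: cmeasurable_indic.
  rewrite EphiE => e e0.
  have mB' : cmeasurable D (cindic R B \o phi).
    have [i1 i2] : cmeasurable setT (cindic R B) by exact: cmeasurable_indic.
    by split; apply: measurable_funTS; [exact: (measurableT_comp i1)|
      exact: (measurableT_comp i2)].
  (* complete systems are defined with the square of the error *)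
  have [||s [c [sL cs]]] := cL (cindic R B \o phi) _ (Num.sqrt e).
  - split; [exact: mB'.1|exact: mB'.2|].
    change (sqnorm (lebn n) D (cindic R B \o phi) < +oo)%E.
    rewrite (_ : cindic R B \o phi = cindic R (phi @^-1` B))//.
    have mpB : measurable (phi @^-1` B) by rewrite -[_ @^-1` _]setTI; exact: mphi.
    rewrite sqnorm_indic//; apply: le_lt_trans Doo.
    by apply: le_measure; rewrite ?inE//; exact: measurableI.
  - by rewrite sqrtr_gt0.
  - exists (fun x => \sum_(l <- s) c l * expo l x); first by exists s, c.
    by move: cs; rewrite sqr_sqrtr// ltW.
have [|||h [s [c [sL ->]]] hs] := @approximable_indic_transfer _ _ _ _ _ (lebn n) mu' phi
  mphi muE D D' mD mD' DD' _ L E mE hull Doo ap f _ _ (e ^+ 2) _.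
- by [].
- exact: foo.
- by rewrite exprn_gt0.
exists s, c; split; first exact: sL.
suff <- : (fun x => f x - \sum_(l <- s) c l * (E l \o phi) x) =
  (fun x => f x - \sum_(l <- s) c l * expo l x) by exact: hs.
by apply/funext => x; congr (_ - _); apply: eq_bigr => l _; rewrite expoE.
Qed.

End spectrum_transfer.

(** Orthogonal exponentials on a bounded set have well separated frequencies:
    for close frequencies the real part of the integrand is positive. *)
Lemma orthogonal_discrete n (D L : set (Rn R n)) : measurable D ->
  bounded_Rn D -> (0 < lebn n D)%E -> orthogonal_system D L -> discrete_Rn L.
Proof.
move=> mD bD D0 orth l Ll; have Doo := bounded_finite bD; have [M DM] := bD.
pose C := `|M| + 1; have C0 : 0 < C by rewrite ltr_wpDl.
have n0 : 0 < n.+1%:R :> R by [].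
(* this threshold makes the phases differ by at most 2 pi / 8 on D *)
exists (8 * n.+1%:R * C)^-1; first by rewrite invr_gt0 !mulr_gt0.
move=> m Lm lm; apply: contrapT => ml.
have /(congr1 (@complex.Re R)) := orth _ _ Ll Lm (nesym ml).
rewrite /inner_L2 /cintegral /=.
have close x : D x -> `|dotp l x - dotp m x| <= 8^-1.
  move=> Dx; rewrite dotpBl (le_trans (ler_norm_sum _ _ _))//.
  apply: (@le_trans _ _ (\sum_(i < n) (8 * n.+1%:R)^-1)).
    apply: ler_sum => i _; rewrite normrM.
    apply: (@le_trans _ _ ((8 * n.+1%:R * C)^-1 * C)).
      apply: ler_pM => //; first exact: ltW.
      by apply: (le_trans (DM x Dx i)); rewrite /C (le_trans (ler_norm M))// lerDl.
    by rewrite invfM -mulrA mulVf ?mulr1// gt_eqF.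
  rewrite sumr_const card_ord invfM -mulrnAr -[leRHS]mulr1 ler_pM2l//.
  by rewrite -mulr_natl ler_pdivrMr// mul1r ler_nat.
pose f (x : Rn R n) := cos (2 * pi * (dotp l x - dotp m x)).
rewrite (_ : (fun x => _) = f); last first.
  by apply/funext => x; rewrite /f mulrBr cosB mulrN opprK.
have fpos x : D x -> 0 < f x.
  move=> /close; rewrite ler_norml => /andP[h1 h2].
  by apply: cos_gt0_pihalf; have := pi_gt0 R; nra.
have mf : measurable_fun D f.
  apply: measurable_funTS; apply: measurable_Rn; apply: measurable_cosC.
  apply: measurable_funM => //; apply: measurable_funB; exact: measurable_dotp.
have mfE : measurable_fun D (EFin \o f) by exact/measurable_EFinP.
have int0 : (0 <= \int[lebn n]_(x in D) (f x)%:E)%E.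
  by apply: integral_ge0 => x Dx; rewrite lee_fin ltW// fpos.
have intoo : (\int[lebn n]_(x in D) (f x)%:E < +oo)%E.
  apply: (@le_lt_trans _ _ (\int[lebn n]_(x in D) 1)%E).
    apply: ge0_le_integral => //.
    - by move=> x Dx; rewrite lee_fin ltW// fpos.
    - by move=> x Dx; rewrite lee_fin cos_le1.
  by rewrite integral_cst// mul1e.
move=> /eqP; rewrite fine_eq0 ?ge0_fin_numE// => /eqP f0.
have : (\int[lebn n]_(x in D) `|(EFin \o f) x| = 0)%E.
  rewrite -[RHS]f0; apply: eq_integral => x /set_mem Dx.
  by rewrite /= gtr0_norm// fpos.
move=> /(ae_eq_integral_abs _ mD mfE)[N [mN N0 DN]].
have : (lebn n D <= lebn n N)%E.
  apply: le_measure; rewrite ?inE//; move=> x Dx; apply: DN => /= /(_ Dx) [fx0].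
  by have := fpos x Dx; rewrite fx0 ltxx.
by rewrite N0 leNgt D0.
Qed.

(** A point of L is determined by a scale 1 / (k + 1) at which it is isolated and
    a rational point within half that scale. *)
Lemma discrete_countable n (L : set (Rn R n)) : discrete_Rn L -> countable L.
Proof.
move=> discL.
have /choice[q qL] (x : Rn R n) : exists q : n.-tuple rat * nat, L x ->
    (forall i, `|tnth x i - ratr (tnth q.1 i)| < (2 * q.2.+1%:R)^-1) /\
    forall y, L y -> (forall i, `|tnth x i - tnth y i| < q.2.+1%:R^-1) -> y = x.
  have [Lx|nLx] := pselect (L x); last by exists ([tuple 0 | _ < n], 0%N).
  have [e e0 xe] := discL x Lx.
  have [k ke] : exists k : nat, k.+1%:R^-1 < e.
    by have [k _ /(_ k (leqnn k))] := near_infty_natSinv_lt (PosNum e0); exists k.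
  have /choice[r rx] (i : 'I_n) : exists r : rat, `|tnth x i - ratr r| < (2 * k.+1%:R)^-1.
    have d0 : 0 < (2 * k.+1%:R)^-1 :> R by rewrite invr_gt0 mulr_gt0.
    move: ((2 * k.+1%:R)^-1 : R) d0 => dl d0.
    have [|r] := @rat_in_itvoo _ (tnth x i) (tnth x i + dl).
      by rewrite ltrDl.
    rewrite in_itv/= => /andP[h1 h2]; exists r; rewrite ltr_norml; apply/andP; split; lra.
  exists ([tuple r i | i < n], k) => _; split=> [i|y Ly yx].
    by rewrite tnth_mktuple.
  by apply: xe => // i; exact: lt_trans ke.
apply/countable_injP; exists (fun x => choice.pickle (q x)) => x y.
rewrite !inE => Lx Ly /(pcan_inj choice.pickleK) qxy.
have [[xq _] [yq yu]] := (qL x Lx, qL y Ly).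
apply: yu => // i; rewrite -qxy in yq *.
have -> : tnth y i - tnth x i =
  (tnth y i - ratr (tnth (q x).1 i)) - (tnth x i - ratr (tnth (q x).1 i)) by ring.
rewrite (le_lt_trans (ler_normB _ _))//.
have -> : (q x).2.+1%:R^-1 = (2 * (q x).2.+1%:R)^-1 + (2 * (q x).2.+1%:R)^-1 :> R.
  by field.
exact: ltrD.
Qed.

End borel_model.

(** * Cylinders *)

Section cylinder.
Context (R : realType) (n : nat).
Variables (I : set R) (Sigma : set (Rn R n)) (Omega : set (Rn R n.+1)).
Hypotheses (bOmega : bounded_Rn Omega) (mOmega : measurable Omega).
Hypotheses (itvI : is_interval I) (mSigma : measurable Sigma).
Hypothesis OmegaE : Omega = @cylinder R n.+1 I Sigma.
Notation nu n := (borel_lebesgue R n).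
Notation lebn n := (@completed_measure_extension _ _ _ (nu n)).
Notation leb := (@lebesgue_measure R).
Hypothesis Omega0 : (0 < lebn n.+1 Omega)%E.

Let in_Omega (t : R) (y : n.-tuple R) : Omega (cons_pair (t, y)) <-> I t /\ Sigma y.
Proof.
rewrite OmegaE /cylinder /= (_ : [tuple of _] = y)//.
exact: val_inj.
Qed.

Let Omega_neq0 : exists t y, I t /\ Sigma y.
Proof.
have /set0P[x] : Omega != set0.
  by apply/eqP => O0; move: Omega0; rewrite O0 measure0 ltxx.
rewrite -(split_tupleK x); case: (split_tuple x) => t y /in_Omega ty.
by exists t, y.
Qed.

Lemma bounded_base : bounded_Rn Sigma.
Proof.
have [t [_ [It _]]] := Omega_neq0; have [M OM] := bOmega.
exists M => y Sy i; have := OM (cons_pair (t, y)) _ (lift ord0 i).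
by rewrite tnthS; apply; apply/in_Omega.
Qed.

(** I is bounded, since a point of the base completes each of its points to one of
    Omega; between its bounds an interval has no gaps. *)
Lemma segment_hull : exists a b : R, a <= b /\
  forall t, ~ ([set a] `|` [set b]) t -> (I t <-> `[a, b]%classic t).
Proof.
have [t0 [y0 [It0 Sy0]]] := Omega_neq0; have [M OM] := bOmega.
have IM t : I t -> `|t| <= M.
  move=> It; have := OM (cons_pair (t, y0)) _ ord0.
  by apply; apply/in_Omega.
have supI : has_sup I.
  by split; [exists t0|exists M => t /IM; rewrite ler_norml => /andP[]].
have infI : has_inf I.
  by split; [exists t0|exists (- M) => t /IM; rewrite ler_norml => /andP[]].
exists (inf I), (sup I); split.
  by apply: (@le_trans _ _ t0); [apply: ge_inf => //; exact: infI.2|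
    apply: ub_le_sup => //; exact: supI.2].
move=> t tab; rewrite /= in_itv/=; split=> [It|].
  by rewrite ge_inf ?ub_le_sup//; [exact: supI.2|exact: infI.2].
rewrite !le_eqVlt => /andP[/orP[/eqP ta|ta] /orP[/eqP tb|tb]].
- by exfalso; apply: tab; left.
- by exfalso; apply: tab; left.
- by exfalso; apply: tab; right.
have [u Iu ut] := inf_lt infI.1 ta; have [v Iv tv] := sup_gt supI.1 tb.
by apply: (itvI Iu Iv); rewrite !ltW.
Qed.

(** The endpoints of I and the error of a Borel model of Sigma each sweep out a null
    set of the product; both factors have positive mass because Omega has. *)
Lemma cylinder_model : exists (a b : R) (S : set (n.-tuple R)) (M : R),
  [/\ a < b, measurable S, 0 < M /\ nu n S = M%:E,
      same_ae (nu n) (idfun : Rn R n -> n.-tuple R) Sigma S &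
      same_ae (leb \x nu n)%E (@split_tuple R n : Rn R n.+1 -> _) Omega
        ((`[a, b]%classic : set (measurableTypeR R)) `*` S)].
Proof.
have [a [b [leab Iab]]] := segment_hull.
have [S mS [N [mN N0] SigmaS]] := hull_id mSigma (bounded_finite bounded_base).
have sameS : same_ae (nu n) (idfun : Rn R n -> n.-tuple R) Sigma S by exists N.
have sameO : same_ae (leb \x nu n)%E (@split_tuple R n : Rn R n.+1 -> _) Omega
    ((`[a, b]%classic : set (measurableTypeR R)) `*` S).
  pose Nab : set (measurableTypeR R) := [set a] `|` [set b].
  have mNab : measurable Nab by apply: measurableU; exact: measurable_set1.
  have Nab0 : leb Nab = 0%E.
    by apply: null_set_setU; [exact: measurable_set1|exact: measurable_set1
      |exact: lebesgue_measure_set1|exact: lebesgue_measure_set1].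
  exists (Nab `*` setT `|` setT `*` N).
    split; first by apply: measurableU; exact: measurableX.
    apply: null_set_setU; [exact: measurableX|exact: measurableX| |].
      by rewrite [LHS]product_measure1E// [X in (X * _)%E]Nab0 mul0e.
    by rewrite [LHS]product_measure1E// [X in (_ * X)%E]N0 mule0.
  move=> x /not_orP[xab xN].
  have {}xab : ~ Nab (split_tuple x).1 by move=> ?; apply: xab.
  have {}xN : ~ N (split_tuple x).2 by move=> ?; apply: xN.
  rewrite -{1}(split_tupleK x); case: (split_tuple x) xab xN => t y /= tab yN.
  rewrite in_Omega; have := Iab t tab; have := SigmaS y yN.
  by rewrite /= => -> ->.
exists a, b, S, (fine (nu n S)).
have muO : lebn n.+1 Omega = (leb (`[a, b]%classic : set (measurableTypeR R)) * nu n S)%E.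
  have mab : measurable (`[a, b]%classic : set (measurableTypeR R)) by exact: measurable_itv.
  rewrite -product_measure1E//.
  exact: (measure_transfer (measurable_Rn (@measurable_split_tuple R n))
    (@lebesgue_split R n) mOmega (measurableX mab mS) sameO).
have Soo : (nu n S < +oo)%E.
  rewrite -(measure_transfer (measurable_Rn (@measurable_id _ _ setT))
    (@lebesgue_id R n) mSigma mS sameS).
  exact: bounded_finite bounded_base.
have Sfin : nu n S = (fine (nu n S))%:E by rewrite fineK// ge0_fin_numE.
have : (0 < leb (`[a, b]%classic : set (measurableTypeR R)) * nu n S)%E by rewrite -muO.
rewrite [X in (_ < X * _)%E -> _]lebesgue_measure_itv/= lte_fin.
case: ifPn => [ab|_]; last by rewrite mul0e ltxx.
rewrite -EFinB Sfin -EFinM lte_fin pmulr_rgt0 ?subr_gt0// => M0.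
Qed.

Let tt (l : n.+1.-tuple R) : R := (split_tuple l).1.
Let ss (l : n.+1.-tuple R) : n.-tuple R := (split_tuple l).2.
Let e (s : n.-tuple R) : n.-tuple R -> R[i] := expo s.
Let EE (l : n.+1.-tuple R) :=
  tensor (fun t : measurableTypeR R => ee (tt l * t)) (e (ss l)).

Let mE l : cmeasurable setT (e l). Proof. exact: cmeasurable_expo. Qed.

Let mEE l : cmeasurable setT (EE l).
Proof.
rewrite -setXTT; apply: cmeasurable_tensor => //.
by apply: cmeasurable_ee; exact: measurable_funM.
Qed.

Let ttss (t : R) (s : n.-tuple R) : exists l, tt l = t /\ ss l = s.
Proof.
exists (cons_pair (t, s)).
by have := cons_pairK (t, s); rewrite /tt /ss => ->.
Qed.

Let mid : measurable_fun setT (idfun : Rn R n -> n.-tuple R).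
Proof. exact: (measurable_Rn (@measurable_id _ _ setT)). Qed.

Let msplit : measurable_fun setT (@split_tuple R n : Rn R n.+1 -> _).
Proof. exact: (measurable_Rn (@measurable_split_tuple R n)). Qed.

Let Sigma_oo : (lebn n Sigma < +oo)%E. Proof. exact: bounded_finite bounded_base. Qed.

Let Omega_oo : (lebn n.+1 Omega < +oo)%E. Proof. exact: bounded_finite bOmega. Qed.

(** Some slice of the spectrum of the cylinder, projected on the base, is a spectrum
    of it. *)
Lemma spectral_base : (exists L, is_spectrum Omega L) -> spectral_set Sigma.
Proof.
move=> [L [discL orthL complL]].
have [a [b [S [M [ab mS [M0 SM] SigmaS OmegaJS]]]]] := cylinder_model.
have mJS : measurable ((`[a, b]%classic : set (measurableTypeR R)) `*` S).
  by apply: measurableX => //; exact: measurable_itv.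
have orthEE l m : L l -> L m -> l <> m -> inner (leb \x nu n)%E
    ((`[a, b]%classic : set (measurableTypeR R)) `*` S) (EE l) (EE m) = 0.
  move=> Ll Lm lm.
  rewrite -(inner_L2_transfer msplit (@lebesgue_split R n) mEE (@expo_split R n)
    mOmega mJS OmegaJS).
  exact: orthL.
have complEE := (complete_system_transfer msplit (@lebesgue_split R n) (@hull_split R n)
  mEE (@expo_split R n) mOmega mJS OmegaJS Omega_oo L).1 complL.
have mEs k : cmeasurable S (e k) by exact: cmeasurable_expo.
have e1 k (y : n.-tuple R) : normc (e k y) ^+ 2 = 1 by exact: normc2_expo.
have [x [orthx apx]] := @slice_spectrum _ _ _ (nu n) a b S M ab mS SM M0 _ _ e tt ss
  mEs e1 ttss L (discrete_countable discL) orthEE complEE.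
have orthS : orthogonal_system Sigma (ss @` slice a b tt L x).
  move=> l m Ll Lm lm.
  rewrite (inner_L2_transfer mid (@lebesgue_id R n) mE (fun _ _ => erefl) mSigma mS SigmaS).
  exact: orthx.
have Sigma0 : (0 < lebn n Sigma)%E.
  by rewrite (measure_transfer mid (@lebesgue_id R n) mSigma mS SigmaS)
    [X in (_ < X)%E]SM lte_fin.
split => //; first exact: bounded_base.
exists (ss @` slice a b tt L x); split => //.
  exact: orthogonal_discrete bounded_base Sigma0 orthS.
exact: (complete_system_transfer mid (@lebesgue_id R n) (@hull_id R n) mE
  (fun _ _ => erefl) mSigma mS SigmaS Sigma_oo _).2.
Qed.

(** The spectrum is the product of the dual lattice of the segment with the
    spectrum of the base. *)
Lemma spectral_cylinder : spectral_set Sigma -> exists L, is_spectrum Omega L.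
Proof.
move=> [_ _ _ [L [discL orthL complL]]].
have [a [b [S [M [ab mS [M0 SM] SigmaS OmegaJS]]]]] := cylinder_model.
have mJ : measurable (`[a, b]%classic : set (measurableTypeR R)).
  exact: measurable_itv.
have mJS := measurableX mJ mS.
have Joo : (leb (`[a, b]%classic : set (measurableTypeR R)) < +oo)%E.
  by rewrite [X in (X < _)%E](lebesgue_segment ab) ltry.
have Soo : (nu n S < +oo)%E by rewrite SM ltry.
have ap := (complete_system_transfer mid (@lebesgue_id R n) (@hull_id R n) mE
  (fun _ _ => erefl) mSigma mS SigmaS Sigma_oo L).1 complL.
pose LL := [set l | freq a b (tt l) /\ L (ss l)].
have mee t : cmeasurable (`[a, b]%classic : set (measurableTypeR R)) (fun x => ee (t * x)).
  by apply: cmeasurable_ee; exact: measurable_funM.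
have mEs k : cmeasurable S (e k) by exact: cmeasurable_expo.
have apLL := @tensor_complete _ _ _ _ _ leb (nu n) _ _ mJ mS Joo Soo _ _ _ _ L
  _ e tt ss mee mEs (fun t x => normc2_ee (t * x)) ttss (fourier_complete ab) ap.
have orthLL : orthogonal_system Omega LL.
  move=> l m [[k lk] Ll] [[k' mk] Lm] lm.
  rewrite (inner_L2_transfer msplit (@lebesgue_split R n) mEE (@expo_split R n)
    mOmega mJS OmegaJS).
  rewrite inner_tensor//; last 4 first.
  - by apply: cbounded_unimodular => // x; exact: normc2_ee.
  - by apply: cbounded_unimodular => // x; exact: normc2_ee.
  - by apply: cbounded_unimodular => // x; exact: normc2_expo.
  - by apply: cbounded_unimodular => // x; exact: normc2_expo.
  have [slm|slm] := eqVneq (ss l) (ss m); last first.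
    rewrite -(inner_L2_transfer mid (@lebesgue_id R n) mE (fun _ _ => erefl)
      mSigma mS SigmaS).
    by rewrite (orthL _ _ Ll Lm (elimN eqP slm)) mulr0.
  rewrite inner_ee (@fwin_eq0 _ _ _ ab _ (k - k')) ?mul0r//.
    rewrite subr_eq0; apply: contra_notN lm => /eqP tlm.
    by rewrite -(split_tupleK l) -(split_tupleK m) [split_tuple l]surjective_pairing
      [split_tuple m]surjective_pairing -/(tt l) -/(ss l) tlm slm.
  by rewrite mulrBl lk mk intrB.
exists LL; split => //; first exact: orthogonal_discrete Omega0 orthLL.
exact: (complete_system_transfer msplit (@lebesgue_split R n) (@hull_split R n)
  mEE (@expo_split R n) mOmega mJS OmegaJS Omega_oo LL).2.
Qed.

End cylinder.

Theorem theorem1p1 (R : realType) (d : nat) (hd : (2 <= d)%N)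
    (I : set R) (Sigma : set (Rn R d.-1)) (Omega : set (Rn R d))
    (hcyl : cylindric Omega I Sigma) (hpos : (0 < lebesgue Omega)%E) :
  spectral_set Omega <-> spectral_set Sigma.
Proof.
case: d hd Sigma Omega hcyl hpos => // n _ Sigma Omega.
move=> [bOmega mOmega itvI mSigma OmegaE] hpos; split.
  move=> [_ _ _ exL].
  exact: (spectral_base bOmega mOmega itvI mSigma OmegaE hpos exL).
move=> spSigma; split => //.
exact: (spectral_cylinder bOmega mOmega itvI mSigma OmegaE hpos spSigma).
Qed.
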